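(* Let $M=(M^1,\dots,M^d)$ be a regular local martingale field such that each $M^i$ depends on the spatial variable only through its $i$-th component, $M^i(t,x,\omega)=M^i(t,x_i,\omega)$. Let $G=H+b$ and $\bar G=\bar H+b$ be admissible drifts with decomposition, with the same $b$, where $b^i(t,x,\omega)$ depends on $x$ only through $x_i$. Let $\mathbb D\subseteq\mathbb R^d$ be a convex closed set with nonempty interior, and assume that the flow $\Psi_{s,t}$ generated by $\mathrm d\psi^i(t)=b^i(t,\psi^i(t))\,\mathrm dt+M^i(\mathrm dt,\psi^i(t))$, $i=1,\dots,d$, satisfies $\Psi_{s,t}(\mathbb D,\omega)=\mathbb D$ for all $t>s\ge 0$, $\omega\in\Omega$. Let $s\ge0$, let $x(t)=x(t,\eta,\omega)$ be a solution of $$\mathrm dx^i(t)=G^i(t,x_t)\,\mathrm dt+M^i(\mathrm dt,x^i(t)),\quad i=1,\dots,d,\ t\ge s,\qquad x_s=\eta,$$ and let $y(t)=y(t,\eta_*,\omega)$ be a solution of $$\mathrm dy^i(t)=\bar G^i(t,y_t)\,\mathrm dt+M^i(\mathrm dt,y^i(t)),\quad i=1,\dots,d,\ t\ge s,\qquad y_s=\eta_*,$$ such that $x(t),y(t)\in\mathbb D$ for $t\in[s,s+T(\omega)]$, where $T(\omega)>0$ for all $\omega\in\Omega$. Assume that $G$ is quasimonotone on $[s,s+T(\omega)]\times\mathbb D$. Then: 1. If $\eta\le\eta_*$ and $G(t,\xi,\omega)\le\bar G(t,\xi,\omega)$ for all $\xi\in C_{\mathbb D}$, $t\in[s,s+T(\omega)]$,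 $\omega\in\Omega$, then $x(t,\eta,\omega)\le y(t,\eta_*,\omega)$ for all $t\in[s,s+T(\omega)]$, $\omega\in\Omega$. 2. If $\eta\ge\eta_*$ and $G(t,\xi,\omega)\ge\bar G(t,\xi,\omega)$ for all $\xi\in C_{\mathbb D}$, $t\in[s,s+T(\omega)]$, $\omega\in\Omega$, then $x(t,\eta,\omega)\ge y(t,\eta_*,\omega)$ for all $t\in[s,s+T(\omega)]$, $\omega\in\Omega$.
   Context: Fix $r>0$, an integer $d\ge1$, and let $C=C([-r,0],\mathbb R^d)$ with the supremum norm $\|\cdot\|_C$. For a continuous function $x$ defined on a set containing $[s-r,s]$, $x_s\in C$ is $x_s(u)=x(s+u)$, $u\in[-r,0]$. For $\mathbb D\subset\mathbb R^d$, $C_{\mathbb D}=\{\eta\in C:\eta(u)\in\mathbb D\ \text{for every }u\in[-r,0]\}$. Inequalities in $\mathbb R^d$ are componentwise; for $\eta,\eta_*\in C$, $\eta\ge\eta_*$ means $\eta^i(u)\ge\eta_*^i(u)$ for all $u\in[-r,0]$, $i=1,\dots,d$. Let $(\Omega,\mathcal F,(\mathcal F_t)_{t\ge0},\mathbf P)$ be a filtered probability space satisfying the usual conditions. The initial datum $\eta$ is a $C$-valued $\mathcal F_s$-measurable random variable and $\eta_*\in C$. Quasimonotone: a random vector field $G=(G^1,\dots,G^d):[0,\infty)\times C\times\Omega\to\mathbb R^d$ is quasimonotone on $[a(\omega),c(\omega)]\times\mathbb D$ (with $[a(\omega),c(\omega)]\subset[0,\infty)$ a random interval) iff for all $\eta,\eta_*\in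 C_{\mathbb D}$, $t\in[a(\omega),c(\omega)]$, $\omega\in\Omega$, $i=1,\dots,d$: $\{\eta\ge\eta_*,\ \eta^i(0)=\eta_*^i(0)\}\Rightarrow G^i(t,\eta,\omega)\ge G^i(t,\eta_*,\omega)$. Regular local martingale field: $M^i:[0,\infty)\times\mathbb R^d\times\Omega\to\mathbb R$, $i=1,\dots,d$, such that (i) $M^i$ is continuous in the first two variables for each $\omega$; (ii) for each $x$, $M^i(\cdot,x)$ is a local martingale with $M^i(0,x,\omega)=0$ for all $\omega$; (iii) there are $\delta\in(0,1)$ and predictable processes $a^{ij}:[0,\infty)\times\mathbb R^{2d}\times\Omega\to\mathbb R$ with $\langle M^i(\cdot,x),M^j(\cdot,y)\rangle_t=\int_0^ta^{ij}(u,x,y,\omega)\,\mathrm du$ a.s. such that, with $\bar a^{ij}=\mathrm D_x\mathrm D_ya^{ij}$ (the matrix of mixed partial derivatives), $$R^{ij}(t,\omega)=\sup_{x,y}\frac{|a^{ij}(t,x,y)|}{(1+|x|)(1+|y|)}+\sup_{x,y}\|\bar a^{ij}(t,x,y)\|+\sup_{x\ne x',\,y\ne y'}\frac{\|\bar a^{ij}(t,x,y)-\bar a^{ij}(t,x,y')-\bar a^{ij}(t,x',y)+\bar a^{ij}(t,x',y')\|}{|x-x'|^\delta|y-y'|^\delta}$$ is finite and $t\mapsto R^{ij}(t,\omega)$ is locally integrable for every $\omega$ and all $i,j$. Admissible drift with decomposition $G=H+b$: $G:[0,\infty)\times C\times\Omega\to\mathbb R^d$ and $G(t,\eta,\omega)=H(t,\eta,\omega)+b(t,\eta(0),\omega)$,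 where each of $G$, $H$ (on $C$) and $b$ (on $\mathbb R^d$ in place of $C$) is (i) jointly continuous in the first two variables for each $\omega$; (ii) for each $\omega$, each $T>0$ and each bounded set $B$, Lipschitz in the second variable on $B$ with a constant $L(T,B,\omega)<\infty$ uniform in $t\in[0,T]$; (iii) $\mathcal F_t$-measurable at time $t$ for each fixed value of the second variable. Moreover $b(t,\cdot)$ is continuously differentiable and there are $\delta>0$ and $c(T,\omega)<\infty$ with $$\sup_{0\le t\le T}\Big\{\sup_x\|\mathrm Db(t,x,\omega)\|+\sup_{x\ne y}\frac{\|\mathrm Db(t,x,\omega)-\mathrm Db(t,y,\omega)\|}{|x-y|^\delta}\Big\}\le c(T,\omega).$$ Flow: $M^i(\mathrm dt,\cdot)$ denotes Kunita's stochastic differential. It is known (Kunita) that the diagonal system $\mathrm d\psi^i=b^i(t,\psi^i)\,\mathrm dt+M^i(\mathrm dt,\psi^i)$ generates a flow $\Psi_{s,t}(x,\omega)=(\psi^1_{s,t}(x_1,\omega),\dots,\psi^d_{s,t}(x_d,\omega))$, $s,t\ge0$, with $\psi^i_{s,s}=\mathrm{id}$, with $(s,t,z)\mapsto\psi^i_{s,t}(z,\omega)$ and its $z$-derivative continuous, each $\psi^i_{s,t}(\cdot,\omega)$ a $C^1$-diffeomorphism of $\mathbb R$, and $\psi^i_{s,u}=\psi^i_{t,u}\circ\psi^i_{s,t}$ for all $s,t,u\ge0$, all $\omega$. This flow is fixed; write $\psi^i(t,z,\omega)=\psi^i_{0,t}(z,\omega)$. Meaning of solution: the equation for $x$ is understood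 through its equivalent pathwise form: $x(t,\omega)=\eta(t-s)$ for $t\in[s-r,s]$ and, for $t\ge s$, $$x^i(t,\omega)=\psi^i\Big(t,\Big[\xi^i(s,\eta^i(0),\omega)+\int_s^tF^i\big(u,\xi^i(u,x^i(u,\omega),\omega),x_u(\omega),\omega\big)\,\mathrm du\Big],\omega\Big),$$ where $\xi^i(u,z,\omega)=\psi^i(u,\cdot,\omega)^{-1}(z)$ and $F^i(u,z,\eta,\omega)=\{\mathrm D_z\psi^i(u,z,\omega)\}^{-1}H^i(u,\eta,\omega)$; similarly for $y$ with $\bar H$ and $\eta_*$. It is known that, on a set of full measure, for all $s$ and all initial functions this pathwise equation has a unique local solution up to an explosion time, depending continuously on $(t,\eta)$. Convention: a null set is discarded so that this holds for every $\omega\in\Omega$ (for all drifts under consideration).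
   Formalization: The initial data η and η_* are additionally assumed to take values in C_D; without this the claim fails, e.g. d=r=1, M=b=0, D=[0,∞), G=Ḡ=|ξ(-1)|, η(u)=5u, η_*=0. *)

(* Defs.v *)
From HB Require Import structures.
From mathcomp Require Import all_boot all_order all_algebra.
From mathcomp Require Import all_classical all_reals all_analysis.

Set Implicit Arguments.
Unset Strict Implicit.
Unset Printing Implicit Defensive.
Import Order.TTheory GRing.Theory Num.Theory.
Import numFieldNormedType.Exports.
Local Open Scope classical_set_scope.
Local Open Scope ring_scope.

(* Time is [R], restricted to [0 <= t] in every definition.  The norms on
   ['rV[R]_d] and ['M[R]_d] are the library's (maximum of the entries). *)

(* The space C([-r,0], R^d).  A history is stored as a function on the whole
   line that is constant on either side of [-r,0], so that equality of
   histories is equality of functions on [-r,0]. *)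
Section history_space.
Context (R : realType) (r : {posnum R}) (d : nat).

Definition clamp (u : R) : R := Num.max (- r%:num) (Num.min u 0).

Definition hist_pred : {pred R -> 'rV[R]_d} :=
  mem [set f : R -> 'rV[R]_d | continuous f /\ forall u, f u = f (clamp u)].

Record hist := Hist { hist_fun :> R -> 'rV[R]_d ; _ : hist_fun \in hist_pred }.

HB.instance Definition _ := [isSub for hist_fun].
HB.instance Definition _ := [Choice of hist by <:].

Lemma clamp_itv u : clamp u \in `[- r%:num, 0].
Proof.
rewrite in_itv/= /clamp le_max lexx/= ge_max ge_min lexx orbT andbT.
by rewrite oppr_le0.
Qed.

Lemma clamp_id u : u \in `[- r%:num, 0] -> clamp u = u.
Proof. by rewrite in_itv/= /clamp => /andP[ru u0]; rewrite min_l// max_r. Qed.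

Lemma clamp_continuous : continuous clamp.
Proof.
move=> u; apply: (@continuous_max _ R^o (cst (- r%:num)) (fun u => Num.min u 0)).
  exact: cvg_cst.
apply: (@continuous_min _ R^o id (cst 0)); [exact: cvg_id|exact: cvg_cst].
Qed.

Lemma hist_predP (f : R -> 'rV[R]_d) :
  reflect (continuous f /\ forall u, f u = f (clamp u)) (f \in hist_pred).
Proof. by apply: (iffP idP) => [/set_mem|/mem_set]. Qed.

Lemma hist_pred_submod : submod_closed hist_pred.
Proof.
split; first by apply/hist_predP; split => // u; exact: cvg_cst.
move=> a f g /hist_predP[cf fE] /hist_predP[cg gE]; apply/hist_predP; split.
  move=> u; apply: (@continuousD _ _ _ (a *: f) g); last exact: cg.
  by apply: (@continuousZr _ _ _ f a); exact: cf.
by move=> u; rewrite !fctE fE gE.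
Qed.

HB.instance Definition _ :=
  GRing.isSubmodClosed.Build R (R -> 'rV[R]_d) hist_pred hist_pred_submod.
HB.instance Definition _ := [SubChoice_isSubLmodule of hist by <:].

Definition sup_norm (eta : hist) : R :=
  sup [set `|eta u| | u in `[- r%:num, 0]%classic].

Lemma hist_continuous (eta : hist) : continuous eta.
Proof. by case: eta => f /= /hist_predP[]. Qed.

Lemma hist_clamp (eta : hist) u : eta u = eta (clamp u).
Proof. by case: eta => f /= /hist_predP[]. Qed.

Lemma sup_norm_has_sup (eta : hist) :
  has_sup [set `|eta u| | u in `[- r%:num, 0]%classic].
Proof.
split; first by exists `|eta 0|, 0 => //=; rewrite in_itv/= lexx andbT oppr_le0.
have ab : - r%:num <= 0 :> R by rewrite oppr_le0.
have ce : {within `[- r%:num, 0], continuous (fun u => `|eta u| : R)}.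
  apply: continuous_subspaceT => u.
  by apply: continuous_comp; [exact: hist_continuous|exact: norm_continuous].
by have [c _ cM] := EVT_max ab ce; exists `|eta c| => _ [u /= /cM uc <-].
Qed.

Lemma sup_norm_ub (eta : hist) u : `|eta u| <= sup_norm eta.
Proof.
rewrite hist_clamp; apply: ub_le_sup; first exact: (sup_norm_has_sup eta).2.
by exists (clamp u) => //=; exact: clamp_itv.
Qed.

Lemma sup_norm_le (eta : hist) M : (forall u, `|eta u| <= M) -> sup_norm eta <= M.
Proof.
move=> etaM; apply: ge_sup; first exact: (sup_norm_has_sup eta).1.
by move=> _ [u _ <-].
Qed.

Lemma sup_normD (eta xi : hist) :
  sup_norm (eta + xi) <= sup_norm eta + sup_norm xi.
Proof.
apply: sup_norm_le => u.
by apply: (le_trans (ler_normD _ _)); rewrite lerD// sup_norm_ub.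
Qed.

Lemma sup_normZ (l : R) (eta : hist) : sup_norm (l *: eta) = `|l| * sup_norm eta.
Proof.
have le_Z k (xi : hist) : sup_norm (k *: xi) <= `|k| * sup_norm xi.
  apply: sup_norm_le => u; change (`|k *: xi u| <= `|k| * sup_norm xi).
  by rewrite normrZ ler_wpM2l// sup_norm_ub.
apply/eqP; rewrite eq_le le_Z/=; have [->|l0] := eqVneq l 0.
  by rewrite normr0 mul0r; apply: (le_trans _ (sup_norm_ub _ 0)).
rewrite -ler_pdivlMl ?normr_gt0// -normfV.
by apply: le_trans (le_Z _ _); rewrite scalerA mulVf// scale1r.
Qed.

Lemma sup_norm0_eq0 (eta : hist) : sup_norm eta = 0 -> eta = 0.
Proof.
move=> eta0; apply/val_inj/funext => u /=; apply/eqP.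
by rewrite -normr_le0 -eta0 sup_norm_ub.
Qed.

HB.instance Definition _ :=
  Lmodule_isNormed.Build R hist sup_normD sup_normZ sup_norm0_eq0.

(* [x_t], for [x] continuous on [t - r, t]; the value is [0] otherwise. *)
Definition hist_at (x : R -> 'rV[R]_d) (t : R) : hist :=
  insubd (0 : hist) (fun u => x (t + clamp u)).

Definition hist_in (D : set 'rV[R]_d) : set hist :=
  [set eta | forall u, u \in `[- r%:num, 0] -> D (eta u)].

Definition vec_le (x y : 'rV[R]_d) := forall i, x 0 i <= y 0 i.

Definition hist_le (eta xi : hist) :=
  forall u, u \in `[- r%:num, 0] -> vec_le (eta u) (xi u).

End history_space.

Section stochastic_basis.
Context (R : realType) (dsp : measure_display) (Omega : measurableType dsp).
Context (P : probability Omega R) (F : R -> set (set Omega)).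

Definition usual_filtration :=
  [/\ forall t, 0 <= t -> sigma_algebra setT (F t) /\ F t `<=` measurable,
      forall s t, 0 <= s -> s <= t -> F s `<=` F t,
      forall t, 0 <= t -> F t = [set A | forall u, t < u -> F u A] &
      P.-negligible `<=` F 0].

(* Borel measurability with respect to the sigma-algebra [A]. *)
Definition measurable_wrt (A : set (set Omega)) (V : topologicalType)
    (f : Omega -> V) := forall U : set V, open U -> A (f @^-1` U).

Definition adapted (X : R -> Omega -> R) :=
  forall t, 0 <= t -> measurable_wrt (F t) (X t).

Definition predictable_rect : set (set (R * Omega)) :=
  [set A | (exists2 B, F 0 B & A = [set 0] `*` B) \/
           (exists s t B, [/\ 0 <= s, s < t, F s B &
                              A = `]s, t]%classic `*` B])].

Definition predictable (X : R -> Omega -> R) := forall U : set R, open U ->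
  <<s [set p : R * Omega | 0 <= p.1], predictable_rect >>
    [set p | 0 <= p.1 /\ U (X p.1 p.2)].

Definition stopping_time (tau : Omega -> \bar R) :=
  (forall w, (0 <= tau w)%E) /\
  (forall t, 0 <= t -> F t [set w | (tau w <= t%:E)%E]).

Definition stopped (X : R -> Omega -> R) (tau : Omega -> \bar R) :=
  fun t w => X (fine (Order.min t%:E (tau w))) w.

(* The last clause says that E[X_t | F_s] = X_s. *)
Definition martingale (X : R -> Omega -> R) :=
  [/\ adapted X,
      forall t, 0 <= t -> P.-integrable setT (EFin \o X t) &
      forall s t A, 0 <= s -> s <= t -> F s A ->
        \int[P]_(w in A) X t w = \int[P]_(w in A) X s w].

Definition local_martingale (X : R -> Omega -> R) :=
  adapted X /\ exists tau : nat -> Omega -> \bar R,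
  [/\ forall n, stopping_time (tau n),
      forall w, {homo (fun n => tau n w) : m n / (m <= n)%N >-> (m <= n)%E},
      {ae P, forall w, tau n w @[n --> \oo] --> +oo%E} &
      forall n, martingale (stopped X (tau n))].

(* [A] is (a version of) the bracket <X, Y>. *)
Definition is_bracket (X Y A : R -> Omega -> R) :=
  [/\ adapted A,
      forall w, A 0 w = 0,
      forall w, {within [set t | 0 <= t], continuous (A ^~ w)},
      forall w T, 0 <= T -> bounded_variation 0 T (A ^~ w) &
      local_martingale (fun t w => X t w * Y t w - A t w)].

Section fields.
Context (d : nat).

(* The matrix with (k, l) entry d^2 a / dx_k dy_l. *)
Definition mixed_derivative (a : 'rV[R]_d -> 'rV[R]_d -> R)
    (x y : 'rV[R]_d) : 'M[R]_d :=
  \matrix_(k, l) 'D_(delta_mx 0 k)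
    (fun x' => 'D_(delta_mx 0 l) (fun y' => a x' y') y) x.

Definition has_mixed_derivative (a : 'rV[R]_d -> 'rV[R]_d -> R) :=
  forall (x y : 'rV[R]_d) k l,
    derivable (fun y' => a x y') y (delta_mx 0 l) /\
    derivable (fun x' => 'D_(delta_mx 0 l) (fun y' => a x' y') y) x
      (delta_mx 0 k).

Definition field_norm (delta : R) (a : 'rV[R]_d -> 'rV[R]_d -> R) : \bar R :=
  let abar := mixed_derivative a in
  (ereal_sup [set z | exists x y,
       z = (`|a x y| / ((1 + `|x|) * (1 + `|y|)))%:E]
   + ereal_sup [set z | exists x y, z = `|abar x y|%:E]
   + ereal_sup [set z | exists x x' y y', [/\ x != x', y != y' &
       z = (`|abar x y - abar x y' - abar x' y + abar x' y'|
            / (`|x - x'| `^ delta * `|y - y'| `^ delta))%:E]])%E.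

Definition regular_local_martingale_field
    (M : 'I_d -> R -> 'rV[R]_d -> Omega -> R) :=
  [/\ forall i w, {within [set p : R * 'rV[R]_d | 0 <= p.1],
        continuous (fun p => M i p.1 p.2 w)},
      forall i x, local_martingale (fun t => M i t x) /\
        forall w, M i 0 x w = 0 &
      exists (delta : R) (a : 'I_d -> 'I_d -> R -> 'rV[R]_d -> 'rV[R]_d ->
                              Omega -> R),
      [/\ 0 < delta < 1,
          forall i j x y, predictable (fun t => a i j t x y),
          forall i j x y, exists2 A,
            is_bracket (fun t => M i t x) (fun t => M j t y) A &
            forall t, 0 <= t -> {ae P, forall w,
              A t w = \int[lebesgue_measure]_(u in `[0, t]) a i j u x y w},
          forall i j t w, 0 <= t ->
            has_mixed_derivative (fun x y => a i j t x y w) /\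
            field_norm delta (fun x y => a i j t x y w) \is a fin_num &
          forall i j w T, 0 < T -> lebesgue_measure.-integrable `[0, T]
            (fun t => field_norm delta (fun x y => a i j t x y w))]].

(* Conditions (i)-(iii) on a drift; used with [V] the space of histories
   and with [V] = R^d. *)
Definition drift_regular (V : normedModType R)
    (H : R -> V -> Omega -> 'rV[R]_d) :=
  [/\ forall w, {within [set p : R * V | 0 <= p.1],
        continuous (fun p => H p.1 p.2 w)},
      forall w T (B : set V), 0 < T -> bounded_set B -> exists L : R,
        forall t u v, 0 <= t <= T -> B u -> B v ->
          `|H t u w - H t v w| <= L * `|u - v| &
      forall t v, 0 <= t -> measurable_wrt (F t) (H t v)].

Definition smooth_drift (b : R -> 'rV[R]_d -> Omega -> 'rV[R]_d) :=
  (forall t w, 0 <= t -> (forall x, differentiable (fun x => b t x w) x) /\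
     continuous (fun x => 'J (fun x => b t x w) x)) /\
  exists2 delta : R, 0 < delta & forall w T, 0 < T -> exists c : R,
    forall t, 0 <= t <= T ->
      let Db x := 'J (fun x => b t x w) x in
      (ereal_sup [set `|Db x|%:E | x in setT]
       + ereal_sup [set z | exists x y, x != y /\
           z = (`|Db x - Db y| / `|x - y| `^ delta)%:E] <= c%:E)%E.

Definition admissible_drift (r : {posnum R})
    (b : R -> 'rV[R]_d -> Omega -> 'rV[R]_d)
    (G H : R -> hist r d -> Omega -> 'rV[R]_d) :=
  [/\ forall t eta w, 0 <= t -> G t eta w = H t eta w + b t (eta 0) w,
      drift_regular G, drift_regular H, drift_regular b & smooth_drift b].

(* Kunita's integral of [m(dt, X_t)] over [s, t]: limit in probability, as
   the mesh tends to 0, of the sums of m(t_{k+1}, X_{t_k}) - m(t_k, X_{t_k}).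
   The list [p] contains the points of the partition other than [s]. *)
Definition kunita_sum (m : R -> R -> Omega -> R) (X : R -> Omega -> R)
    (s : R) (p : seq R) (w : Omega) : R :=
  \sum_(k < size p)
    let u := nth s (s :: p) k in let v := nth s p k in
    (m v (X u w) w - m u (X u w) w).

Definition is_kunita_integral (m : R -> R -> Omega -> R)
    (X : R -> Omega -> R) (s t : R) (I : Omega -> R) :=
  forall e e' : R, 0 < e -> 0 < e' -> exists2 rho : R, 0 < rho &
    forall p, itv_partition s t p ->
      (forall k, (k < size p)%N -> nth s p k - nth s (s :: p) k < rho) ->
      (P [set w | (e < `|kunita_sum m X s p w - I w|)%R] <= e'%:E)%E.

Definition C1 (f : R -> R) :=
  (forall z, derivable f z 1) /\ continuous (derive1 f).

Definition C1_diffeomorphism (f : R -> R) :=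
  exists g, [/\ cancel f g, cancel g f, C1 f & C1 g].

(* [psi i s t z w] is psi^i_{s,t}(z, w).  As M^i(t, x) and b^i(t, x) depend on
   [x] only through [x_i], M^i(t, z) for [z : R] is M^i(t, (z, ..., z)). *)
Definition generates_flow (M : 'I_d -> R -> 'rV[R]_d -> Omega -> R)
    (b : R -> 'rV[R]_d -> Omega -> 'rV[R]_d)
    (psi : 'I_d -> R -> R -> R -> Omega -> R) :=
  forall i s z t, 0 <= s -> s <= t ->
    measurable_wrt (F t) (psi i s t z) /\
    is_kunita_integral (fun u y => M i u (const_mx y))
      (fun u => psi i s u z) s t
      (fun w => psi i s t z w - z -
         \int[lebesgue_measure]_(u in `[s, t])
           b u (const_mx (psi i s u z w)) w 0 i).

Definition C1_flow (psi : 'I_d -> R -> R -> R -> Omega -> R) :=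
  forall i w,
  [/\ forall s z, 0 <= s -> psi i s s z w = z,
      {within [set p : R * R * R | 0 <= p.1.1 /\ 0 <= p.1.2],
        continuous (fun p => psi i p.1.1 p.1.2 p.2 w)},
      {within [set p : R * R * R | 0 <= p.1.1 /\ 0 <= p.1.2],
        continuous (fun p => derive1 (fun z => psi i p.1.1 p.1.2 z w) p.2)},
      forall s t, 0 <= s -> 0 <= t ->
        C1_diffeomorphism (fun z => psi i s t z w) &
      forall s t u z, 0 <= s -> 0 <= t -> 0 <= u ->
        psi i s u z w = psi i t u (psi i s t z w) w].

Definition flow_map (psi : 'I_d -> R -> R -> R -> Omega -> R) (s t : R)
    (w : Omega) (x : 'rV[R]_d) : 'rV[R]_d := \row_i psi i s t (x 0 i) w.

Section equation.
Context (r : {posnum R}) (psi : 'I_d -> R -> R -> R -> Omega -> R).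
Context (H : R -> hist r d -> Omega -> 'rV[R]_d).

(* xi^i(u, ., w), the inverse of psi^i(u, ., w) = psi^i_{0,u}(., w). *)
Definition flow_inv (i : 'I_d) (u z : R) (w : Omega) : R :=
  'pinv_(fun=> 0) setT (fun y => psi i 0 u y w) z.

Definition flow_drift (i : 'I_d) (u z : R) (eta : hist r d) (w : Omega) : R :=
  (derive1 (fun y => psi i 0 u y w) z)^-1 * H u eta w 0 i.

(* [x] solves the equation with [x_s = phi] on the set [J] of times [t >= s],
   at the sample point [w]. *)
Definition is_solution (w : Omega) (s : R) (phi : hist r d) (J : set R)
    (x : R -> 'rV[R]_d) :=
  [/\ {within `[s - r%:num, s]%classic `|` J, continuous x},
      forall t, t \in `[s - r%:num, s] -> x t = phi (t - s) &
      forall t i, J t -> x t 0 i =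
        psi i 0 t
          (flow_inv i s (phi 0 0 i) w +
           \int[lebesgue_measure]_(u in `[s, t])
             flow_drift i u (flow_inv i u (x u 0 i) w) (hist_at r x u) w) w].

(* At [w], for each initial time and initial function there is a unique
   local solution up to an explosion time [tau phi], and it depends
   continuously on time and the initial function. *)
Definition well_posed (w : Omega) :=
  forall s, 0 <= s -> exists (tau : hist r d -> \bar R)
                             (x : hist r d -> R -> 'rV[R]_d),
  let dom := [set p : R * hist r d | s <= p.1 /\ (p.1%:E < tau p.2)%E] in
  [/\ forall phi, (s%:E < tau phi)%E /\
        is_solution w s phi [set t | dom (t, phi)] (x phi),
      forall phi, (tau phi < +oo)%E ->
        forall K : R, exists2 t, dom (t, phi) & K < `|x phi t|,
      forall phi (sigma : \bar R) y,
        is_solution w s phi [set t | s <= t /\ (t%:E < sigma)%E] y ->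
        (sigma <= tau phi)%E /\
        forall t, s <= t -> (t%:E < sigma)%E -> y t = x phi t,
      forall p, dom p -> \forall q \near p, s <= q.1 -> dom q &
      {within dom, continuous (fun p => x p.2 p.1)}].

End equation.

(* Quasimonotonicity on [a(w), c(w)] x D for the sample points in [Omega0]. *)
Definition quasimonotone (r : {posnum R}) (Omega0 : set Omega)
    (G : R -> hist r d -> Omega -> 'rV[R]_d) (a c : Omega -> R)
    (D : set 'rV[R]_d) :=
  forall (eta eta' : hist r d) t w i, hist_in D eta -> hist_in D eta' ->
    Omega0 w -> a w <= t <= c w ->
    hist_le eta' eta -> eta 0 0 i = eta' 0 0 i ->
    G t eta' w 0 i <= G t eta w 0 i.

End fields.
End stochastic_basis.

(* Main.v *)
Require Import Defs.
From HB Require Import structures.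
From mathcomp Require Import all_boot all_order all_algebra.
From mathcomp Require Import all_classical all_reals all_analysis.
From mathcomp Require Import lra ring.

(** At a fixed sample point, pull the paths back by the flow.  If [x] solves the
    equation, then [X^i(t) = psi^i(t, .)^-1 (x^i(t))] is continuously
    differentiable and its derivative is [H^i(t, x_t)] times a positive factor
    that depends continuously on [t] and [X^i(t)].  As [psi^i(t, .)] is
    increasing, [x] and [y] are ordered like their pullbacks.  When two ordered
    paths first touch, in a component [i], both factors agree; the drifts are in
    the order given by quasimonotonicity and by the comparison of [G] with the
    drift of [y].  If this order is strict, the derivatives contradict the order
    of the paths before ([strict_comparison]).  As the two drifts share [b], and
    [b^i] only depends on the component [i], what holds for [G] holds for [H].

    It remains to perturb [x] so as to obtain strict inequalities.  This meets
    two obstacles.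

    First, a perturbed path may leave [D], where quasimonotonicity ends, and [D]
    need not be a lattice.  By convexity and an interior point, histories [eta]
    and [zeta] in [D] that satisfy [eta <= zeta + e] and
    [|eta^i(0) - zeta^i(0)| <= e] still satisfy [H^i(eta) <= H^i(zeta) + K e]
    ([quasimonotone_estimate]).  Hence [H] may be replaced by its composition
    with the metric projection to a bounded truncation of [D], minus [K] times
    the distance that the projection moves the history.  The new drift agrees
    with [H] along [x], and below a path in [D] it has the required order also
    outside of [D] ([pert_key]).

    Second, the factor is merely continuous, so that no Gronwall argument gets
    from a strict to a weak comparison.  Instead uniqueness and continuous
    dependence on the initial history are used, for countably many drifts, so
    that only one null set is discarded.  A further term
    [- |eta^j(p - t) - q|], with [p] and [q] rational, compares with [q] the
    value of the path at a time [p] shortly before [s].  It vanishes along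
    paths that have the value [q] there and is active on nearby ones.  Shifting
    the initial history of [x] first to reach a rational value and then away
    from it gives paths that converge to [x] and lie strictly below [y]
    ([comparison_short]).  This works on a time step of length [r / 2], and
    steps are iterated ([comparison_steps]).  The opposite comparison is
    obtained with the sign [sg = -1]. *)

Import Order.TTheory GRing.Theory Num.Theory.
Import numFieldNormedType.Exports.
Local Open Scope classical_set_scope.
Local Open Scope ring_scope.
Set Implicit Arguments.
Unset Strict Implicit.
Unset Printing Implicit Defensive.
(** * Row vectors and metric projection *)

Section projection.
Context {R : realType} {d : nat}.
Implicit Types (x y c : 'rV[R]_d) (E : set 'rV[R]_d).

Lemma entry_le_norm x i : `|x 0 i| <= `|x|.
Proof.
rewrite [leRHS]/Num.Def.normr/= mx_normrE; apply/bigmax_geP; right => /=.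
by exists (0, i).
Qed.

Lemma norm_le_entries x e : 0 <= e -> (forall i, `|x 0 i| <= e) -> `|x| <= e.
Proof.
move=> e0 xe; rewrite [leLHS]/Num.Def.normr/= mx_normrE bigmax_le// => -[j i] _ /=.
by rewrite (ord1 j).
Qed.

Definition convex_rV E := forall x y l, E x -> E y -> 0 <= l <= 1 ->
  E (l *: x + (1 - l) *: y).

Lemma convex_rVP E : @convex_set R 'rV[R]_d E -> convex_rV E.
Proof.
move=> cE x y l Ex Ey l01.
have /set_mem := cE x y (Itv01 (andP l01).1 (andP l01).2) (mem_set Ex) (mem_set Ey).
by [].
Qed.

Definition sqdist x y : R := \sum_i (x 0 i - y 0 i) ^+ 2.

Lemma continuous_entry (i : 'I_d) : continuous (fun x : 'rV[R]_d => x 0 i).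
Proof. exact: coord_continuous. Qed.

Lemma sqdist_continuous x : continuous (sqdist x).
Proof.
apply: (@continuous_big _ _ _ _ _ add_continuous) => i _ y.
apply: (@continuous_comp _ _ _ (fun y : 'rV[R]_d => x 0 i - y 0 i)
  (fun z => z ^+ 2)).
  by apply: continuousB; [exact: cst_continuous|exact: continuous_entry].
exact: exprn_continuous.
Qed.

(** The Euclidean distance is used here because nearest points for the sup norm
    are neither unique nor a Lipschitz function of [x]. *)
Definition nearest E x : 'rV[R]_d :=
  xget 0 [set c | E c /\ forall y, E y -> sqdist x c <= sqdist x y].

Lemma nearestP E x : compact E -> E !=set0 ->
  E (nearest E x) /\ forall y, E y -> sqdist x (nearest E x) <= sqdist x y.
Proof.
move=> cE E0; rewrite /nearest; case: xgetP => [c _ []//|].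
have [|c /set_mem Ec cmin] := EVT_min_rV (f := sqdist x) E0 cE.
  by apply: continuous_subspaceT; exact: sqdist_continuous.
by move=> /(_ c)[]; split => // y Ey; apply: cmin; exact/mem_set.
Qed.

Lemma nearest_id E x : compact E -> E x -> nearest E x = x.
Proof.
move=> cE Ex; have [|_ /(_ x Ex)] := nearestP x cE; first by exists x.
rewrite [leRHS]big1 => [|i _]; last by rewrite subrr expr0n.
move=> le0; apply/rowP => i; apply/eqP.
have : sqdist x (nearest E x) == 0.
  by rewrite eq_le le0 sumr_ge0// => j _; exact: sqr_ge0.
rewrite psumr_eq0 => [/allP/(_ i)|j _]; last exact: sqr_ge0.
by rewrite mem_index_enum sqrf_eq0 subr_eq0 eq_sym; exact.
Qed.

(** A step from the nearest point towards a point of [E] stays in [E] and hence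
    does not decrease the distance to [x]. *)
Lemma nearest_obtuse E x y : compact E -> convex_rV E -> E y ->
  \sum_i (x 0 i - nearest E x 0 i) * (y 0 i - nearest E x 0 i) <= 0.
Proof.
move=> cE vE Ey; have [|Ec cmin] := nearestP x cE; first by exists y.
set c := nearest E x in Ec cmin *; rewrite leNgt; apply/negP.
set S := \sum_i _ => S0; pose Q := sqdist y c.
have Q0 : 0 <= Q by apply: sumr_ge0 => i _; exact: sqr_ge0.
have SQ0 : 0 < S + Q by lra.
(* The parabola [l |-> - 2 l S + l^2 Q] is negative at this [l]. *)
pose l := S / (S + Q).
have l0 : 0 < l by rewrite divr_gt0.
have l1 : l <= 1 by rewrite ler_pdivrMr// mul1r lerDl.
have : sqdist x (l *: y + (1 - l) *: c) = sqdist x c - 2 * l * S + l ^+ 2 * Q.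
  rewrite /sqdist /S /Q /sqdist !mulr_sumr -sumrB -big_split.
  by apply: eq_bigr => i _ /=; rewrite !mxE; ring.
have := cmin _ (vE _ _ _ Ey Ec (introT andP (conj (ltW l0) l1))).
move=> /[swap] -> h.
have : l * Q <= S by rewrite /l mulrAC ler_pdivrMr//; nra.
by nra.
Qed.

(** The projection is nonexpansive for the Euclidean norm; the factor [d] is the
    price of the sup norm. *)
Lemma nearest_lipschitz E x y : compact E -> convex_rV E -> E !=set0 ->
  `|nearest E x - nearest E y| <= d%:R * `|x - y|.
Proof.
move=> cE vE E0; have [Ea _] := nearestP x cE E0; have [Eb _] := nearestP y cE E0.
have := nearest_obtuse y cE vE Ea; have := nearest_obtuse x cE vE Eb.
set a := nearest E x; set b := nearest E y => obx oby.
have [->|ab0] := eqVneq `|a - b| 0; first by rewrite mulr_ge0.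
have ab_gt0 : 0 < `|a - b| by rewrite lt_def ab0 normr_ge0.
rewrite -(ler_pM2r ab_gt0).
have [[j i] abi] := mx_norm_neq0 ab0.
have le1 : `|a - b| * `|a - b| <= \sum_i (a 0 i - b 0 i) ^+ 2.
  have -> : `|a - b| = `|a 0 i - b 0 i|.
    by rewrite [LHS]abi /= (ord1 j) !mxE.
  rewrite -expr2 real_normK ?num_real// (bigD1 i)//= lerDl.
  by apply: sumr_ge0 => k _; exact: sqr_ge0.
apply: (le_trans le1).
have le2 : \sum_i (a 0 i - b 0 i) ^+ 2 <=
    \sum_i (x 0 i - y 0 i) * (a 0 i - b 0 i).
  rewrite -subr_le0 -sumrB.
  apply: le_trans (_ : _ <= 0 + 0) _; last by rewrite addr0.
  apply: le_trans (lerD obx oby).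
  by rewrite -big_split le_eqVlt; apply/orP; left; apply/eqP/eq_bigr => k _ /=; ring.
apply: (le_trans le2); rewrite -mulrA mulr_natl.
have -> : `|x - y| * `|a - b| *+ d = \sum_(i < d) `|x - y| * `|a - b|.
  by rewrite sumr_const card_ord.
apply: ler_sum => k _; apply: (le_trans (ler_norm _)); rewrite normrM ler_pM//.
  by have := entry_le_norm (x - y) k; rewrite !mxE.
by have := entry_le_norm (a - b) k; rewrite !mxE.
Qed.

End projection.

(** * Continuity on subsets *)

Section within.
Context {T U V : topologicalType}.

Lemma within_comp (A : set T) (B : set U) (g : T -> U) (f : U -> V) :
  {within A, continuous g} -> {within B, continuous f} ->
  (forall x, A x -> B (g x)) -> {within A, continuous (f \o g)}.
Proof.
move=> /subspace_continuousP cg /subspace_continuousP cf AB.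
apply/subspace_continuousP => x Ax.
move=> W nW; have := cg x Ax _ (cf _ (AB _ Ax) _ nW).
rewrite !nbhs_simpl /within /= => h.
near=> y => Ay; have : A y -> B (g y) -> W (f (g y)) by near: y.
by apply => //; exact: AB.
Unshelve. all: by end_near. Qed.

Lemma within_pair (A : set T) (g : T -> U) (f : T -> V) :
  {within A, continuous g} -> {within A, continuous f} ->
  {within A, continuous (fun x => (g x, f x))}.
Proof. by move=> cg cf x; apply: cvg_pair; [exact: cg|exact: cf]. Qed.

Lemma within_setT (f : T -> U) : {within setT, continuous f} -> continuous f.
Proof.
move=> /subspace_continuousP cf x; have := cf x I.
by rewrite withinET.
Qed.

End within.

Lemma lipschitz_continuous (R : realType) (V W : normedModType R) (f : V -> W)
    (K : R) : (forall x y, `|f x - f y| <= K * `|x - y|) -> continuous f.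
Proof.
move=> fK x; apply/cvgrPdist_lt => e e0.
have K0 : 0 < `|K| + 1 by rewrite ltr_wpDl.
apply/nbhs_ballP; exists (e / (`|K| + 1)); first by rewrite /= divr_gt0.
move=> y; rewrite -ball_normE/= ltr_pdivlMr// => xy.
apply: le_lt_trans (fK _ _) (le_lt_trans _ xy).
rewrite mulrC ler_wpM2l// (le_trans (ler_norm _))//; lra.
Qed.

(** * Histories *)

Section histories.
Context {R : realType} {r : {posnum R}} {d : nat}.
Implicit Types (eta zeta : hist r d) (x : R -> 'rV[R]_d).

Lemma clamp0 : clamp r 0 = 0 :> R.
Proof. by rewrite clamp_id// in_itv/= lexx andbT oppr_le0. Qed.

Lemma hist_ext eta zeta : (forall u, eta u = zeta u) -> eta = zeta.
Proof. by move=> e; apply/val_inj/funext. Qed.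

Lemma hist_norm_ub eta u : `|eta u| <= `|eta|.
Proof. exact: sup_norm_ub. Qed.

Lemma hist_norm_le eta (e : R) : (forall u, `|eta u| <= e) -> `|eta| <= e.
Proof. exact: sup_norm_le. Qed.

Lemma hist_subE eta zeta u : (eta - zeta) u = eta u - zeta u.
Proof. by []. Qed.

Lemma hist_atE x t u : continuous (fun u => x (t + clamp r u)) ->
  hist_at r x t u = x (t + clamp r u).
Proof.
move=> cx; rewrite /hist_at val_insubd ifT//; apply/hist_predP; split => // v.
by rewrite (clamp_id (clamp_itv r v)).
Qed.

Lemma clamp_shift_continuous t : continuous (fun u => t + clamp r u : R).
Proof.
move=> u; apply: continuousD; first exact: cst_continuous.
exact: clamp_continuous.
Qed.

Lemma clamp_shift_itv t u : t - r%:num <= t + clamp r u <= t.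
Proof.
have := clamp_itv r u; rewrite in_itv/= => /andP[h1 h2].
by apply/andP; split; lra.
Qed.

Lemma hist_at_within x (A : set R) t u : {within A, continuous x} ->
  (forall v, t - r%:num <= v <= t -> A v) ->
  hist_at r x t u = x (t + clamp r u).
Proof.
move=> cx At; apply/hist_atE/within_setT.
apply: (within_comp (continuous_subspaceT (@clamp_shift_continuous t)) cx).
by move=> w _; exact/At/clamp_shift_itv.
Qed.

Lemma hist_at_cont x t u : continuous x -> hist_at r x t u = x (t + clamp r u).
Proof.
move=> cx; apply: hist_atE => v; apply: continuous_comp; last exact: cx.
exact: clamp_shift_continuous.
Qed.

Lemma hist_eval_continuous : continuous (fun p : R * hist r d => p.2 p.1).
Proof.
move=> [u eta]; apply/cvgrPdist_lt => e e0 /=.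
have e2 : 0 < e / 2 by lra.
have /cvgrPdist_lt/(_ _ e2) nu := @hist_continuous _ _ _ eta u.
exists ([set v | `|eta u - eta v| < e / 2], ball eta (e / 2)).
  by split => //=; exact: nbhsx_ballx.
move=> [v zeta] /= [uv]; rewrite -ball_normE/= => ez.
have -> : eta u - zeta v = (eta u - eta v) + (eta - zeta) v.
  by rewrite hist_subE addrA subrK.
rewrite (splitr e); apply: (le_lt_trans (ler_normD _ _)); rewrite ltrD//.
exact: le_lt_trans (hist_norm_ub _ _) ez.
Qed.

(** Continuity of [x] at each time [t + u] is uniform in [u] because [[-r, 0]]
    is compact. *)
Lemma hist_at_continuous x : continuous x -> continuous (hist_at r x).
Proof.
move=> cx t; have hE t' u := hist_at_cont t' u cx.
apply/cvgrPdist_le => e e0.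
have cov : compact `[- r%:num, 0 : R] by exact: segment_compact.
have h := iffLR (compact_near_coveringP _) cov R (nbhs t)
  (fun t' u => `|x (t + u) - x (t' + u)| <= e) (nbhs_filter t).
 apply: filterS (h _) => [t' ht'|u _].
  apply: hist_norm_le => u; rewrite hist_subE !hE.
  exact/ht'/clamp_itv.
have e2 : 0 < e / 2 by lra.
have /cvgrPdist_lt/(_ _ e2) /nbhs_ballP[a /= a0 ax] := cx (t + u).
have a2 : 0 < a / 2 by lra.
exists (ball u (a / 2), ball t (a / 2)); first by split; exact: nbhsx_ballx.
move=> [v t'] [/=]; rewrite /ball/= => uv tt'.
have -> : x (t + v) - x (t' + v) =
    (x (t + u) - x (t' + v)) - (x (t + u) - x (t + v)).
  by rewrite opprB [RHS]addrC addrA subrK.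
rewrite (splitr e); apply: (le_trans (ler_normB _ _)).
apply: lerD; apply/ltW/ax; rewrite /ball/=.
  rewrite (_ : _ - _ = (u - v) + (t - t')); last by ring.
  by rewrite (splitr a); apply: le_lt_trans (ler_normD _ _) _; rewrite ltrD.
rewrite (_ : _ - _ = u - v); [lra|ring].
Qed.

Lemma hist_at_within_continuous x (a b : R) : {within `[a, b], continuous x} ->
  {within `[a + r%:num, b], continuous (hist_at r x)}.
Proof.
move=> cx; have [ab|ba] := leP a b; last first.
  rewrite set_itv_ge ?bnd_simp -?ltNge; first exact: continuous_subspace0.
  by rewrite (lt_le_trans ba)// lerDl.
(* Freezing [x] outside of [[a, b]] makes it continuous everywhere and does not
   affect the histories at times in [[a + r, b]]. *)
pose k t := Num.max a (Num.min t b); pose z := x \o k.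
have kab t : a <= k t <= b by rewrite /k le_max lexx/= ge_max ab ge_min lexx orbT.
have cz : continuous z.
  apply/within_setT/(within_comp (continuous_subspaceT _) cx) => [t|t _]; last first.
    by rewrite /= in_itv/=.
  apply: (@continuous_max _ R^o (cst a) (fun u => Num.min u b)).
    exact: cvg_cst.
  apply: (@continuous_min _ R^o id (cst b)); [exact: cvg_id|exact: cvg_cst].
apply: (@subspace_eq_continuous _ _ _ (hist_at r z)); last first.
  by apply: continuous_subspaceT; exact: hist_at_continuous.
move=> t; rewrite inE/= in_itv/= => /andP[at_ tb]; apply: hist_ext => u.
rewrite (hist_at_cont _ _ cz).
rewrite (hist_at_within _ cx); last first.
  by move=> v /andP[tv vt] /=; rewrite in_itv/=; lra.
rewrite /z /=; congr (x _); rewrite /k; have := clamp_shift_itv t u.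
move=> /andP[h1 h2]; rewrite min_l ?max_r//; lra.
Qed.

Definition hist_map (f : 'rV[R]_d -> 'rV[R]_d) eta := hist_at r (f \o eta) 0.

Lemma hist_mapE f eta u : continuous f -> hist_map f eta u = f (eta u).
Proof.
move=> cf; have c : continuous (f \o eta).
  by move=> v; apply: continuous_comp; [exact: hist_continuous|exact: cf].
by rewrite /hist_map hist_at_cont// add0r /= -hist_clamp.
Qed.

Definition cst_hist (c : 'rV[R]_d) : hist r d := hist_map (cst c) 0.

Lemma cst_histE c u : cst_hist c u = c.
Proof. by rewrite hist_mapE//; exact: cst_continuous. Qed.

Lemma norm_cst_hist (c : R) : `|cst_hist (const_mx c)| <= `|c|.
Proof.
apply: hist_norm_le => u; rewrite cst_histE.
by apply: norm_le_entries => // i; rewrite mxE.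
Qed.

Lemma hist_inP (D : set 'rV[R]_d) eta : hist_in D eta <-> forall u, D (eta u).
Proof.
by split=> h u => [|_]; [rewrite hist_clamp; exact/h/clamp_itv|exact: h].
Qed.

Lemma hist_leP eta zeta : hist_le eta zeta <-> forall u, vec_le (eta u) (zeta u).
Proof.
split=> h u => [|_]; last exact: h.
by rewrite hist_clamp (hist_clamp zeta); exact/h/clamp_itv.
Qed.

End histories.

(** * One-sided Lipschitz estimate for quasimonotone drifts *)

Section row_max.
Context {R : realType} {d : nat}.

Definition row_max (c : R) (x : 'rV[R]_d) : 'rV[R]_d := \row_j Num.max (x 0 j) c.

Lemma row_max_continuous c : continuous (row_max c).
Proof.
apply: (@lipschitz_continuous _ _ _ _ 1) => x y; rewrite mul1r.
apply: norm_le_entries => [//|j].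
rewrite !mxE; apply: le_trans (_ : `|x 0 j - y 0 j| <= _); last first.
  by have := entry_le_norm (x - y) j; rewrite !mxE.
rewrite /Num.max; case: (ltP (x 0 j) c) => h1; case: (ltP (y 0 j) c) => h2;
  rewrite ?subrr ?normr0// ler_norml;
  by have [h3|h3] := ger0P (x 0 j - y 0 j); apply/andP; split; lra.
Qed.

End row_max.

Section quasimonotone_estimate.
Context {R : realType} {r : {posnum R}} {d : nat}.
Variables (E : set 'rV[R]_d) (z0 : 'rV[R]_d) (rho N : R).
Hypotheses (cE : convex_rV E) (rho0 : 0 < rho).
Hypothesis ballE : forall x, `|x - z0| <= rho -> E x.
Hypothesis EN : forall x, E x -> `|x| <= N.
Implicit Types (eta zeta : hist r d) (h : hist r d -> 'rV[R]_d).

Lemma hist_in_norm eta : hist_in E eta -> `|eta| <= N.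
Proof. by move=> /hist_inP Eeta; apply: hist_norm_le => u; exact: EN. Qed.

(** [eta] and [zeta] need not be comparable, and [E] need not contain their
    maximum.  Contracting both towards the interior point [z0] by the factor
    [1 - l], with [l = e / (e + rho)], makes room for raising [zeta] above
    [eta] inside [E], at the price of moving both by [O(e)]. *)
Lemma quasimonotone_estimate h (L e : R) (i : 'I_d) eta zeta :
  (forall xi xi', hist_in E xi -> hist_in E xi' -> hist_le xi' xi ->
     xi 0 0 i = xi' 0 0 i -> h xi' 0 i <= h xi 0 i) ->
  0 <= L ->
  (forall xi xi', `|xi| <= N -> `|xi'| <= N ->
     `|h xi - h xi'| <= L * `|xi - xi'|) ->
  hist_in E eta -> hist_in E zeta -> 0 <= e ->
  (forall u j, eta u 0 j <= zeta u 0 j + e) ->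
  `|eta 0 0 i - zeta 0 0 i| <= e ->
  h eta 0 i <= h zeta 0 i + 4 * N * L / rho * e.
Proof.
move=> qm L0 lip Eeta Ezeta e_ge0 le_e eq_e.
have [e0|e0] := eqVneq e 0.
  rewrite e0 mulr0 addr0; apply: qm => //; last first.
    by move: eq_e; rewrite e0 normr_le0 subr_eq0 => /eqP.
  by apply/hist_leP => u j; rewrite -[leRHS]addr0 -e0.
have {e0}e_gt0 : 0 < e by rewrite lt_def e0.
have er : 0 < e + rho by rewrite addr_gt0.
pose l := e / (e + rho); pose c := eta 0 0 i - zeta 0 0 i.
have l0 : 0 <= l by rewrite divr_ge0// ltW.
have l1 : l <= 1 by rewrite ler_pdivrMr// mul1r lerDl ltW.
(* Raising [zeta] by [up] in the contracted picture moves [z0] by at most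
   [(rho / e) * e]. *)
have lE : 1 - l = l * (rho / e).
  by rewrite /l; field; rewrite !gt_eqF.
(* Adding [up] raises [zeta] above [eta]; in component [i] at time [0] it closes
   the gap exactly. *)
pose up := hist_map (row_max c) (eta - zeta).
have upE u j : up u 0 j = Num.max (eta u 0 j - zeta u 0 j) c.
  by rewrite hist_mapE ?mxE//; exact: row_max_continuous.
have up_le u j : `|up u 0 j| <= e.
  move: eq_e; rewrite upE -/c !ler_norml => /andP[c1 c2].
  by rewrite le_max c1 orbT/= ge_max c2 andbT lerBlDl.
pose cst_z0 : hist r d := cst_hist z0.
have cst_z0E u : cst_z0 u = z0 := cst_histE z0 u.
have Ecst : hist_in E cst_z0.
  by apply/hist_inP => u; rewrite cst_z0E; apply: ballE; rewrite subrr normr0 ltW.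
pose v := cst_z0 + (rho / e) *: up.
have Ev : hist_in E v.
  apply/hist_inP => u; apply: ballE.
  have -> : v u - z0 = (rho / e) *: up u.
    by rewrite [v u](_ : _ = cst_z0 u + (rho / e) *: up u)// cst_z0E addrC addKr.
  apply: norm_le_entries => [|j]; first exact: ltW.
  have re0 : 0 <= rho / e by rewrite divr_ge0// ltW.
  rewrite mxE normrM (ger0_norm re0).
  by apply: le_trans (ler_wpM2l re0 (up_le u j)) _; rewrite divfK ?gt_eqF.
have mix (xi xi' : hist r d) : hist_in E xi -> hist_in E xi' ->
    [/\ hist_in E (l *: xi + (1 - l) *: xi'),
      `|xi' - (l *: xi + (1 - l) *: xi')| <= 2 * N / rho * e &
      forall u j, (l *: xi + (1 - l) *: xi') u 0 j =
        l * xi u 0 j + (1 - l) * xi' u 0 j].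
  move=> Exi Exi'; split.
  - move: Exi Exi' => /hist_inP Exi /hist_inP Exi'; apply/hist_inP => u.
    by apply: cE (Exi u) (Exi' u) _; rewrite l0.
  - rewrite (_ : _ - _ = l *: (xi' - xi)); last first.
      apply: hist_ext => u; apply/rowP => j.
      change ((xi' u - (l *: xi u + (1 - l) *: xi' u)) 0 j =
        (l *: (xi' u - xi u)) 0 j).
      by rewrite !mxE; ring.
    rewrite normrZ ger0_norm//.
    have le1 : `|xi' - xi| <= 2 * N.
      apply: le_trans (ler_normB _ _) _.
      by rewrite mulr_natl mulr2n lerD//; exact: hist_in_norm.
    have le2 : l <= e / rho by rewrite ler_pM2l// lef_pV2 ?posrE// lerDr ltW.
    rewrite (_ : 2 * N / rho * e = e / rho * (2 * N)); last by ring.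
    by rewrite ler_pM.
  - move=> u j; change ((l *: xi u + (1 - l) *: xi' u) 0 j =
      l * xi u 0 j + (1 - l) * xi' u 0 j).
    by rewrite !mxE.
have [Ee' ne' e'E] := mix _ _ Ecst Eeta; have [Ez' nz' z'E] := mix _ _ Ev Ezeta.
set eta' := _ + _ in Ee' ne' e'E; set zeta' := _ + _ in Ez' nz' z'E.
have diffE u j : zeta' u 0 j - eta' u 0 j =
    (1 - l) * (up u 0 j - (eta u 0 j - zeta u 0 j)).
  rewrite e'E z'E cst_z0E.
  rewrite (_ : v u = cst_z0 u + (rho / e) *: up u)// cst_z0E !mxE lE.
  by ring.
have h' : h eta' 0 i <= h zeta' 0 i.
  apply: qm => //; last first.
    by apply/eqP; rewrite -subr_eq0 diffE upE -/c maxxx subrr mulr0.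
  apply/hist_leP => u j; rewrite -subr_ge0 diffE mulr_ge0 ?subr_ge0//.
  by rewrite upE le_max lexx.
have lip_i (xi xi' : hist r d) : hist_in E xi -> hist_in E xi' ->
    `|h xi 0 i - h xi' 0 i| <= L * `|xi - xi'|.
  move=> Exi Exi'; apply: le_trans (lip _ _ (hist_in_norm Exi) (hist_in_norm Exi')).
  by have := entry_le_norm (h xi - h xi') i; rewrite !mxE.
have := le_trans (lip_i _ _ Eeta Ee') (ler_wpM2l L0 ne').
have := le_trans (lip_i _ _ Ezeta Ez') (ler_wpM2l L0 nz').
rewrite !ler_norml => /andP[_ k1] /andP[_ k2].
rewrite (_ : 4 * N * L / rho * e = 2 * (L * (2 * N / rho * e))); last by ring.
have := lip_i _ _ Ezeta Ez'; rewrite distrC ler_norml => /andP[_ k3].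
have := ler_wpM2l L0 nz'; lra.
Qed.

End quasimonotone_estimate.

(** * Admissibility of the perturbed drifts *)

Section measurability.
Context {R : realType} {dsp : measure_display} {Omega : measurableType dsp}.
Variable (A : set (set Omega)).
Hypothesis sA : sigma_algebra setT A.

Lemma sigma_algebra_bigcup (I : countType) (B : I -> set Omega) :
  (forall i, A (B i)) -> A (\bigcup_i B i).
Proof.
case: sA => A0 _ AU AB.
rewrite (_ : \bigcup_i B i =
  \bigcup_n (if unpickle n is Some i then B i else set0)).
  by apply: AU => n; case: unpickle.
apply/seteqP; split=> [w [i _ Bw]|w [n _]].
  by exists (pickle i) => //; rewrite pickleK.
by case: unpickle => // i Bw; exists i.
Qed.

Lemma sigma_algebra_setI (B C : set Omega) : A B -> A C -> A (B `&` C).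
Proof.
move=> AB AC2; have [A0 Acpl _] := sA.
have -> : B `&` C =
    setT `\` \bigcup_(b : bool) (setT `\` (if b then B else C)).
  rewrite !setTD setC_bigcup; apply/seteqP; split=> [w [Bw Cw] [] _|w h].
  - by rewrite setTD setCK.
  - by rewrite setTD setCK.
  - by split; [have := h true I|have := h false I]; rewrite setTD setCK.
by apply: (Acpl); apply: sigma_algebra_bigcup => -[]; exact: Acpl.
Qed.

Lemma measurable_wrt_cst (V : topologicalType) (c : V) :
  measurable_wrt A (fun _ : Omega => c).
Proof.
case: sA => A0 Acpl _ U oU.
have [Uc|Uc] := pselect (U c).
  rewrite (_ : _ @^-1` U = setT `\` set0); first exact: Acpl.
  by rewrite setD0; apply/seteqP; split.
by rewrite (_ : _ @^-1` U = set0)//; apply/seteqP; split.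
Qed.

Lemma rat_row_dense d (x : 'rV[R]_d) (e : R) : 0 < e ->
  exists p : 'rV[rat]_d, `|x - map_mx ratr p| < e.
Proof.
move=> e0; have e2 : 0 < e / 2 by lra.
have /choice[f fP] (i : 'I_d) : exists q : rat, `|x 0 i - ratr q| <= e / 2.
  have [q] := @rat_in_itvoo R (x 0 i - e / 2) (x 0 i + e / 2) ltac:(lra).
  rewrite in_itv/= => /andP[q1 q2]; exists q.
  by rewrite ler_norml; apply/andP; split; lra.
exists (\row_i f i); apply: le_lt_trans (_ : _ <= e / 2) _; last by lra.
by apply: norm_le_entries => [|i]; [lra|rewrite !mxE].
Qed.

(** The event [X + Y \in U] is a countable union, over rational balls [B], of
    the events that [X] is in [B] and that [Y] is in the interior of the set of
    the [y] with [B + y] inside [U]. *)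
Lemma measurable_wrtD d (X Y : Omega -> 'rV[R]_d) :
  measurable_wrt A X -> measurable_wrt A Y -> measurable_wrt A (X \+ Y).
Proof.
move=> mX mY U oU.
pose B (p : 'rV[rat]_d) (n : nat) : set 'rV[R]_d :=
  ball (map_mx ratr p : 'rV[R]_d) n.+1%:R^-1.
pose W p n : set 'rV[R]_d :=
  interior [set y | forall x, B p n x -> U (x + y)].
rewrite (_ : _ @^-1` U = \bigcup_(k : 'rV[rat]_d * nat)
    (X @^-1` B k.1 k.2 `&` Y @^-1` W k.1 k.2)).
  apply: sigma_algebra_bigcup => k; apply: sigma_algebra_setI.
    by apply: mX; exact: ball_open.
  by apply: mY; exact: open_interior.
apply/seteqP; split=> w /=; last first.
  by move=> [[p n] _ /= [BX /interior_subset]]; exact.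
move=> UXY; have {UXY} : nbhs (X w + Y w) U by exact: open_nbhs_nbhs.
move=> /nbhs_ballP[e /= e0 eU].
have e3 : 0 < e / 3 by lra.
have [n ne] : exists n, n.+1%:R^-1 < e / 3.
  have [N _ /(_ N (leqnn _)) h] := near_infty_natSinv_lt (PosNum e3).
  by exists N.
have n0 : 0 < n.+1%:R^-1 :> R by rewrite invr_gt0.
have [p pX] := rat_row_dense (X w) n0.
exists (p, n) => //=; split; first by rewrite /B -ball_normE /= distrC.
apply/nbhs_ballP; exists n.+1%:R^-1; first by rewrite /= invr_gt0.
move=> y; rewrite -ball_normE/= => Yy x; rewrite /B -ball_normE/= => px.
apply: eU; rewrite -ball_normE/=.
rewrite (_ : _ - _ = (X w - map_mx ratr p) + (map_mx ratr p - x) + (Y w - y)).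
  apply: le_lt_trans (ler_normD _ _) _.
  apply: le_lt_trans (_ : _ <=
    `|X w - map_mx ratr p| + `|map_mx ratr p - x| + `|Y w - y|) _.
    by rewrite lerD2r ler_normD.
  apply: lt_trans (_ : n.+1%:R^-1 + n.+1%:R^-1 + n.+1%:R^-1 < _).
    by rewrite !ltrD.
  rewrite (_ : e = e / 3 + e / 3 + e / 3); first by rewrite !ltrD.
  by field.
by rewrite opprD addrACA; congr (_ + _); rewrite addrA subrK.
Qed.

End measurability.

Section drift_regularity.
Context {R : realType} {dsp : measure_display} {Omega : measurableType dsp}.
Variable (F : R -> set (set Omega)).
Hypothesis sF : forall t, 0 <= t -> sigma_algebra setT (F t).
Context {d : nat}.

Lemma drift_regular_comp (V W : normedModType R) (H : R -> W -> Omega -> 'rV[R]_d)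
    (f : V -> W) (K : R) : (forall u v, `|f u - f v| <= K * `|u - v|) ->
  drift_regular F H -> drift_regular F (fun t v w => H t (f v) w).
Proof.
move=> fK [cH lH mH]; have cf := lipschitz_continuous fK.
have K1 : 0 < `|K| + 1 by rewrite ltr_wpDl.
have fK1 u v : `|f u - f v| <= (`|K| + 1) * `|u - v|.
  apply: le_trans (fK _ _) _; rewrite ler_wpM2r//.
  by rewrite (le_trans (ler_norm _))// lerDl.
split=> [w|w T B T0 bB|t v t0]; last exact: mH.
  apply: (within_comp (g := fun p : R * V => (p.1, f p.2)) _ (cH w)) => //.
  apply: continuous_subspaceT => p.
  apply: (@cvg_pair _ _ _ (nbhs p) (nbhs p.1) (nbhs (f p.2)) _ _ _
    (fun p : R * V => p.1) (fun p => f p.2)); first exact: cvg_fst.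
  by apply: (@cvg_comp _ _ _ _ f _ _ _ _ (cf p.2)); exact: cvg_snd.
have bfB : bounded_set (f @` B).
  have [M [Mr MB]] := bB.
  exists (`|f 0| + (`|K| + 1) * (`|M| + 1)); split; first exact: num_real.
  move=> x Mx _ [v Bv <-]; apply: ltW; apply: le_lt_trans Mx.
  rewrite -[f v](subrK (f 0)) [leRHS]addrC; apply: le_trans (ler_normD _ _) _.
  rewrite lerD2r; apply: le_trans (fK1 _ _) _; rewrite subr0 ler_pM2l//.
  by apply: MB => //; rewrite (le_lt_trans (ler_norm _))// ltrDl.
have [L LB] := lH w T _ T0 bfB; exists (`|L| * (`|K| + 1)) => t u v tT Bu Bv.
apply: le_trans (LB t (f u) (f v) tT _ _) _; [by exists u|by exists v|].
apply: le_trans (ler_wpM2r (normr_ge0 _) (ler_norm L)) _.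
by rewrite -mulrA ler_wpM2l.
Qed.

Lemma drift_regularD (V : normedModType R) (H H' : R -> V -> Omega -> 'rV[R]_d) :
  drift_regular F H -> drift_regular F H' ->
  drift_regular F (fun t v w => H t v w + H' t v w).
Proof.
move=> [cH lH mH] [cH' lH' mH']; split=> [w|w T B T0 bB|t v t0].
- by move=> p; apply: cvgD; [exact: cH|exact: cH'].
- have [L LB] := lH w T B T0 bB; have [L' LB'] := lH' w T B T0 bB.
  exists (L + L') => t u v tT Bu Bv; rewrite opprD addrACA mulrDl.
  by apply: le_trans (ler_normD _ _) _; rewrite lerD ?LB ?LB'.
- by apply: measurable_wrtD; [exact: sF|exact: mH|exact: mH'].
Qed.

Lemma drift_regular_const (V : normedModType R) (g : R -> V -> R) (K : R) :
  continuous (fun p : R * V => g p.1 p.2) ->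
  (forall t u v, `|g t u - g t v| <= K * `|u - v|) ->
  drift_regular F (fun t v (_ : Omega) => const_mx (g t v) : 'rV[R]_d).
Proof.
move=> cg gK.
have lip (a b : R) : `|const_mx a - const_mx b : 'rV[R]_d| <= 1 * `|a - b|.
  by apply: norm_le_entries => [|i]; rewrite mul1r// !mxE.
split=> [w|w T B T0 bB|t v t0].
- apply: continuous_subspaceT => p.
  apply: (@cvg_comp _ _ _ (fun p : R * V => g p.1 p.2)
    (fun a => const_mx a : 'rV[R]_d) _ _ _ (cg p)).
  exact: (lipschitz_continuous lip).
- exists K => t u v _ _ _; apply: le_trans (lip _ _) _.
  by rewrite mul1r gK.
- by apply: measurable_wrt_cst; exact: sF.
Qed.

End drift_regularity.

Section perturbation.
Context {R : realType} {dsp : measure_display} {Omega : measurableType dsp}.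
Context {r : {posnum R}} {d : nat}.

Definition proj_hist (E : set 'rV[R]_d) (eta : hist r d) : hist r d :=
  hist_map (nearest E) eta.

(** The first term measures how far a history leaves [E].  The second one
    compares with [q] the value that a path took at time [p] in the component
    [i0]: along a path it is constant as long as [p] belongs to the memory
    [[t - r, t]]. *)
Definition penalty (E : set 'rV[R]_d) (i0 : 'I_d) (k l p q t : R)
    (eta : hist r d) : R :=
  k * `|eta - proj_hist E eta| + l * `|eta (p - t) 0 i0 - q|.

Definition perturbed_drift E i0 k l p q (H : R -> hist r d -> Omega -> 'rV[R]_d)
    t eta w : 'rV[R]_d :=
  H t (proj_hist E eta) w + const_mx (penalty E i0 k l p q t eta).

Variables (E : set 'rV[R]_d).
Hypotheses (kE : compact E) (cE : convex_rV E) (E0 : E !=set0).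

Lemma nearest_continuous : continuous (nearest E).
Proof. by apply: lipschitz_continuous => x y; exact: nearest_lipschitz. Qed.

Lemma proj_histE eta u : proj_hist E eta u = nearest E (eta u).
Proof. by rewrite hist_mapE//; exact: nearest_continuous. Qed.

Lemma proj_hist_in eta : hist_in E (proj_hist E eta).
Proof. by apply/hist_inP => u; rewrite proj_histE; exact: (nearestP _ kE E0).1. Qed.

Lemma proj_hist_id eta : hist_in E eta -> proj_hist E eta = eta.
Proof.
move=> /hist_inP Eeta; apply: hist_ext => u; rewrite proj_histE.
exact: nearest_id.
Qed.

Lemma proj_hist_lipschitz eta zeta :
  `|proj_hist E eta - proj_hist E zeta| <= d%:R * `|eta - zeta|.
Proof.
apply: hist_norm_le => u; rewrite hist_subE !proj_histE.
apply: le_trans (nearest_lipschitz _ _ kE cE E0) _.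
by rewrite ler_wpM2l// -hist_subE hist_norm_ub.
Qed.

Lemma penalty_lipschitz i0 k l p q t eta zeta :
  `|penalty E i0 k l p q t eta - penalty E i0 k l p q t zeta| <=
  (`|k| * (1 + d%:R) + `|l|) * `|eta - zeta|.
Proof.
rewrite /penalty opprD addrACA -!mulrBr mulrDl.
apply: le_trans (ler_normD _ _) _; rewrite !normrM -mulrA lerD// ler_wpM2l//.
  apply: le_trans (ler_dist_dist _ _) _.
  have -> : (eta - proj_hist E eta) - (zeta - proj_hist E zeta) =
      (eta - zeta) - (proj_hist E eta - proj_hist E zeta).
    apply: hist_ext => u; apply/rowP => j.
    change ((eta u - proj_hist E eta u - (zeta u - proj_hist E zeta u)) 0 j =
      (eta u - zeta u - (proj_hist E eta u - proj_hist E zeta u)) 0 j).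
    by rewrite !mxE; ring.
  apply: le_trans (ler_normB _ _) _.
  by rewrite mulrDl mul1r lerD2l proj_hist_lipschitz.
apply: le_trans (ler_dist_dist _ _) _.
rewrite opprB addrA subrK.
have := entry_le_norm ((eta - zeta) (p - t)) i0; rewrite hist_subE !mxE => h.
by apply: (le_trans h); rewrite -hist_subE hist_norm_ub.
Qed.

Lemma penalty_continuous i0 k l p q :
  continuous (fun z : R * hist r d => penalty E i0 k l p q z.1 z.2).
Proof.
move=> [t eta]; rewrite /penalty /=.
have cproj :
    (fun z : R * hist r d => proj_hist E z.2) @ (t, eta) --> proj_hist E eta.
  apply: (@cvg_comp _ _ _ (fun z : R * hist r d => z.2) (proj_hist E) _ (nbhs eta)).
    exact: cvg_snd.
  exact: (lipschitz_continuous proj_hist_lipschitz).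
have ceval : (fun z : R * hist r d => z.2 (p - z.1)) @ (t, eta) --> eta (p - t).
  apply: (@cvg_comp _ _ _ (fun z : R * hist r d => (p - z.1, z.2))
    (fun z : R * hist r d => z.2 z.1) _ (nbhs (p - t, eta))); last first.
    exact: (@hist_eval_continuous _ _ _ (p - t, eta)).
  apply: (@cvg_pair _ _ _ (nbhs (t, eta)) (nbhs (p - t)) (nbhs eta) _ _ _
    (fun z : R * hist r d => p - z.1) (fun z => z.2)).
    by apply: cvgB; [exact: cvg_cst|exact: cvg_fst].
  exact: cvg_snd.
have cMr (c : R) (f : R * hist r d -> R) (m : R) : f @ (t, eta) --> m ->
    (fun z => c * f z) @ (t, eta) --> c * m.
  by move=> fm; apply: cvgM fm; exact: cvg_cst.
apply: cvgD; apply: cMr; apply: cvg_norm.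
  by apply: cvgB => //; exact: cvg_snd.
apply: cvgB; last exact: cvg_cst.
apply: (@cvg_comp _ _ _ (fun z : R * hist r d => z.2 (p - z.1))
  (fun x : 'rV[R]_d => x 0 i0) _ _ _ ceval).
exact: continuous_entry.
Qed.

Lemma hist_eval0_lipschitz (eta zeta : hist r d) :
  `|eta 0 - zeta 0| <= 1 * `|eta - zeta|.
Proof. by rewrite mul1r -hist_subE hist_norm_ub. Qed.

Lemma perturbed_admissible (F : R -> set (set Omega)) b G H i0 k l p q :
  (forall t, 0 <= t -> sigma_algebra setT (F t)) ->
  admissible_drift F b G H ->
  admissible_drift F b
    (fun t eta w => perturbed_drift E i0 k l p q H t eta w + b t (eta 0) w)
    (perturbed_drift E i0 k l p q H).
Proof.
move=> sF [_ _ rH rb sb].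
have rpert : drift_regular F (perturbed_drift E i0 k l p q H).
  apply: drift_regularD => //.
    exact: (drift_regular_comp proj_hist_lipschitz).
  apply: drift_regular_const (penalty_lipschitz i0 k l p q) => //.
  exact: penalty_continuous.
split=> //; apply: drift_regularD => //.
exact: (drift_regular_comp hist_eval0_lipschitz).
Qed.

End perturbation.

(** * The flow at a sample point *)

Section flow.
Context {R : realType} {dsp : measure_display} {Omega : measurableType dsp}.
Context {d : nat} {psi : 'I_d -> R -> R -> R -> Omega -> R}.
Hypothesis hpsi : C1_flow psi.
Variable w : Omega.
Implicit Types (i : 'I_d) (t z : R).

Lemma flow_backK i t z : 0 <= t -> psi i t 0 (psi i 0 t z w) w = z.
Proof. by move=> t0; have [h0 _ _ _ hc] := hpsi i w; rewrite -hc// h0. Qed.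

Lemma flow_forthK i t z : 0 <= t -> psi i 0 t (psi i t 0 z w) w = z.
Proof. by move=> t0; have [h0 _ _ _ hc] := hpsi i w; rewrite -hc// h0. Qed.

Lemma flow_invE i t z : 0 <= t -> flow_inv psi i t z w = psi i t 0 z w.
Proof.
move=> t0; rewrite /flow_inv -[in LHS](@flow_forthK i t z t0).
rewrite (@pinvKV _ _ (fun=> 0) setT (fun y => psi i 0 t y w))//.
  move=> y y' _ _ /= e; rewrite -(@flow_backK i t y t0) e flow_backK//.
by rewrite inE.
Qed.

Lemma flow_invK i t z : 0 <= t -> psi i 0 t (flow_inv psi i t z w) w = z.
Proof. by move=> t0; rewrite flow_invE// flow_forthK. Qed.

Lemma flowK i t z : 0 <= t -> flow_inv psi i t (psi i 0 t z w) w = z.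
Proof. by move=> t0; rewrite flow_invE// flow_backK. Qed.

Lemma flow_inv_continuous i :
  {within [set p : R * R | 0 <= p.1],
    continuous (fun p => flow_inv psi i p.1 p.2 w)}.
Proof.
have [_ cpsi _ _ _] := hpsi i w.
apply: (@subspace_eq_continuous _ _ _ (fun p : R * R => psi i p.1 0 p.2 w)).
  by move=> p; rewrite inE/= => p0; apply/esym; exact: flow_invE.
apply: (within_comp (g := fun p : R * R => (p.1, 0, p.2)) _ cpsi) => //=.
apply: continuous_subspaceT => p.
apply: (@cvg_pair _ _ _ (nbhs p) (nbhs (p.1, 0)) (nbhs p.2) _ _ _
  (fun p : R * R => (p.1, 0 : R)) (fun p => p.2)); last exact: cvg_snd.
apply: (@cvg_pair _ _ _ (nbhs p) (nbhs p.1) (nbhs (0 : R)) _ _ _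
  (fun p : R * R => p.1) (fun p => 0 : R)); [exact: cvg_fst|exact: cvg_cst].
Qed.

Lemma flow_deriv_continuous i :
  {within [set p : R * R | 0 <= p.1],
    continuous (fun p => derive1 (fun y => psi i 0 p.1 y w) p.2)}.
Proof.
have [_ _ cpsi _ _] := hpsi i w.
apply: (within_comp (g := fun p : R * R => (0, p.1, p.2)) _ cpsi) => //=.
apply: continuous_subspaceT => p.
apply: (@cvg_pair _ _ _ (nbhs p) (nbhs (0, p.1)) (nbhs p.2) _ _ _
  (fun p : R * R => (0 : R, p.1)) (fun p => p.2)); last exact: cvg_snd.
apply: (@cvg_pair _ _ _ (nbhs p) (nbhs (0 : R)) (nbhs p.1) _ _ _
  (fun p : R * R => 0 : R) (fun p => p.1)); [exact: cvg_cst|exact: cvg_fst].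
Qed.

Lemma flow_derivable i t z : 0 <= t -> derivable (fun y => psi i 0 t y w) z 1.
Proof.
move=> t0; have [_ _ _ h _] := hpsi i w.
by have [g [_ _ [+ _] _]] := h 0 t (lexx _) t0.
Qed.

Lemma flow_deriv_neq0 i t z : 0 <= t -> derive1 (fun y => psi i 0 t y w) z != 0.
Proof.
move=> t0; have [_ _ _ h _] := hpsi i w.
have [g [fK gK [df _] [dg _]]] := h 0 t (lexx _) t0.
set f := fun y => psi i 0 t y w in fK gK df *.
have : derive1 (g \o f) z = 1.
  rewrite (_ : g \o f = id); last by apply/funext.
  by rewrite derive1E derive_id.
rewrite derive1_comp// => gf1; apply: contra_eq_neq gf1 => ->.
by rewrite mulr0 eq_sym oner_neq0.
Qed.

(** The derivative never vanishes, is [1] at time [0], and is continuous in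
    time. *)
Lemma flow_deriv_gt0 i t z : 0 <= t -> 0 < derive1 (fun y => psi i 0 t y w) z.
Proof.
move=> t0; pose f u := derive1 (fun y => psi i 0 u y w) z.
rewrite -/(f t) ltNge; apply/negP => ft0.
have f0 : f 0 = 1.
  rewrite /f (_ : (fun y => _) = id); first by rewrite derive1E derive_id.
  by apply/funext => y; have [h0 _ _ _ _] := hpsi i w; rewrite h0.
have cf : {within `[0, t], continuous f}.
  apply: (within_comp (g := fun u : R => (u, z)) _ (@flow_deriv_continuous i)).
    apply: continuous_subspaceT => u.
    apply: (@cvg_pair _ _ _ (nbhs u) (nbhs u) (nbhs z) _ _ _
      (fun u : R => u) (fun=> z)); [exact: cvg_id|exact: cvg_cst].
  by move=> u /=; rewrite in_itv/= => /andP[].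
have v0 : Num.min (f 0) (f t) <= 0 <= Num.max (f 0) (f t).
  by rewrite f0 ge_min le_max ft0 ler01 orbT.
have [u] := IVT t0 cf v0.
rewrite in_itv/= => /andP[u0 _] fu0.
by have := flow_deriv_neq0 i z u0; rewrite -/(f u) fu0 eqxx.
Qed.

Lemma flow_mono i t : 0 <= t -> {mono (fun z => psi i 0 t z w) : z z' / z <= z'}.
Proof.
move=> t0; apply: le_mono => z z' zz'.
pose f y := psi i 0 t y w.
have df y : y \in `]z, z'[ -> is_derive y 1 f (derive1 f y).
  by move=> _; apply: DeriveDef; [exact: flow_derivable|rewrite derive1E].
have cf : {within `[z, z'], continuous f}.
  apply: continuous_subspaceT => y; apply: differentiable_continuous.
  by apply/derivable1_diffP; exact: flow_derivable.
have [c _] := MVT zz' df cf.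
by move=> e; rewrite -subr_gt0 e mulr_gt0 ?flow_deriv_gt0// subr_gt0.
Qed.

Lemma flow_inv_lt i t z z' : 0 <= t ->
  (flow_inv psi i t z w < flow_inv psi i t z' w) = (z < z').
Proof.
by move=> t0; rewrite -(leW_mono (flow_mono i t0)) !flow_invK.
Qed.

End flow.

(** * Solutions of the pathwise equation *)

Section solutions.
Context {R : realType} {dsp : measure_display} {Omega : measurableType dsp}.
Context {d : nat} {r : {posnum R}} {psi : 'I_d -> R -> R -> R -> Omega -> R}.
Hypothesis hpsi : C1_flow psi.
Variable w : Omega.
Implicit Types (H : R -> hist r d -> Omega -> 'rV[R]_d) (x : R -> 'rV[R]_d).
Implicit Types (i : 'I_d) (s S t : R) (phi : hist r d) (J : set R).

Definition drift_continuous H := {within [set p : R * hist r d | 0 <= p.1],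
  continuous (fun p => H p.1 p.2 w)}.

(** The time derivative of the pulled back path [flow_inv psi i u (x u 0 i) w]
    of a solution [x]. *)
Definition rate H x i u : R :=
  flow_drift psi H i u (flow_inv psi i u (x u 0 i) w) (hist_at r x u) w.

Lemma is_solutionW H s phi J J' x : J' `<=` J ->
  is_solution psi H w s phi J x -> is_solution psi H w s phi J' x.
Proof.
move=> J'J [cx ex sx]; split=> // [|t i J't]; last exact/sx/J'J.
by apply: continuous_subspaceW cx; exact: setUS.
Qed.

(** The integral equation only sees the drift along the path. *)
Lemma eq_is_solution H H' s phi J x :
  (forall t u, J t -> s <= u <= t ->
    H u (hist_at r x u) w = H' u (hist_at r x u) w) ->
  is_solution psi H w s phi J x -> is_solution psi H' w s phi J x.
Proof.
move=> HH' [cx ex sx]; split=> // t i Jt; rewrite sx//.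
congr psi; congr +%R; apply: eq_Rintegral => u; rewrite inE/= in_itv/= => ust.
by rewrite /flow_drift (HH' t).
Qed.

Section path.
Variables (H : R -> hist r d -> Omega -> 'rV[R]_d) (s S : R) (phi : hist r d)
  (x : R -> 'rV[R]_d).
Hypotheses (s0 : 0 <= s) (cH : drift_continuous H).
Hypothesis solx : is_solution psi H w s phi `[s, S] x.

Lemma solution_continuous : {within `[s - r%:num, S], continuous x}.
Proof.
have [cx _ _] := solx; apply: continuous_subspaceW cx => t /=.
rewrite !in_itv/= => /andP[h1 h2]; have [ts|ts] := leP t s; [left|right].
  by rewrite h1.
by rewrite (ltW ts).
Qed.

Lemma solution_hist_at t u : t \in `[s, S] ->
  hist_at r x t u = x (t + clamp r u).
Proof.
rewrite in_itv/= => /andP[st tS]; apply: (hist_at_within _ solution_continuous).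
move=> v /andP[h1 h2] /=; rewrite in_itv/=; lra.
Qed.

Lemma solution_init u : phi u = x (s + clamp r u).
Proof.
have [_ ex _] := solx; have := clamp_itv r u; rewrite in_itv/= => /andP[h1 h2].
rewrite ex; first by rewrite addrC addKr -hist_clamp.
by rewrite in_itv/=; lra.
Qed.

Lemma solution_before t : s - r%:num <= t <= s -> x t = phi (t - s).
Proof. by move=> ts; have [_ + _] := solx; apply; rewrite in_itv/=. Qed.

Lemma solution_hist_in (D : set 'rV[R]_d) t : hist_in D phi ->
  (forall t', t' \in `[s, S] -> D (x t')) -> t \in `[s, S] ->
  hist_in D (hist_at r x t).
Proof.
move=> /hist_inP Dphi Dx tJ; apply/hist_inP => u; rewrite solution_hist_at//.
move: tJ; rewrite in_itv/= => /andP[st tS].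
have := clamp_shift_itv (r := r) t u; set t1 := t + clamp r u => /andP[h1 h2].
have [t1s|t1s] := leP t1 s.
  by rewrite solution_before// t1s andbT; lra.
by apply: Dx; rewrite in_itv/= (ltW t1s) (le_trans h2).
Qed.

Lemma solution_hist_past t p : t \in `[s, S] -> s - r%:num <= p <= s ->
  t - r%:num <= p -> hist_at r x t (p - t) = phi (p - s).
Proof.
move=> tJ ps tp; rewrite solution_hist_at//; move: tJ; rewrite in_itv/=.
move=> /andP[st _]; rewrite clamp_id; last first.
  by rewrite in_itv/= lerBrDl tp subr_le0 (le_trans (andP ps).2).
by rewrite addrC subrK solution_before.
Qed.

Lemma coord_within_continuous i : {within `[s, S], continuous (fun u => x u 0 i)}.
Proof.
apply: (within_comp (B := setT) (f := fun z : 'rV[R]_d => z 0 i) _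
  (continuous_subspaceT (@continuous_entry _ _ i))) => //.
apply: continuous_subspaceW solution_continuous => t /=.
by rewrite !in_itv/= => /andP[st ->]; rewrite andbT lerBlDr (le_trans st)// lerDl.
Qed.

Lemma pullback_continuous i :
  {within `[s, S], continuous (fun u => flow_inv psi i u (x u 0 i) w)}.
Proof.
apply: (within_comp (g := fun u : R => (u, x u 0 i))
  _ (@flow_inv_continuous _ _ _ _ _ hpsi w i)).
  apply: within_pair; last exact: coord_within_continuous.
  by apply: continuous_subspaceT => u; exact: cvg_id.
by move=> u /=; rewrite in_itv/= => /andP[su _]; exact: le_trans su.
Qed.

Lemma rate_continuous i : {within `[s, S], continuous (rate H x i)}.
Proof.
have cid : {within `[s, S], continuous (fun u : R => u)}.
  by apply: continuous_subspaceT => u; exact: cvg_id.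
have s_pos u : `[s, S]%classic u -> 0 <= u.
  by rewrite /= in_itv/= => /andP[su _]; exact: le_trans su.
have c1 := within_comp (within_pair cid (@pullback_continuous i))
  (@flow_deriv_continuous _ _ _ _ _ hpsi w i) s_pos.
have ch : {within `[s, S], continuous (hist_at r x)}.
  rewrite -[X in `[X, _]](subrK r%:num).
  exact: hist_at_within_continuous solution_continuous.
have c2 := within_comp (within_pair cid ch) cH s_pos.
move/subspace_continuousP: c1 => c1; move/subspace_continuousP: c2 => c2.
apply/subspace_continuousP => u Ju; apply: cvgM.
  by apply: cvgV; [rewrite gt_eqF// flow_deriv_gt0// s_pos|exact: c1].
apply: (@cvg_comp _ _ _ (fun u => H u (hist_at r x u) w)
  (fun z : 'rV[R]_d => z 0 i) _ _ _ (c2 u Ju)).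
exact: continuous_entry.
Qed.

Lemma rate_integrable i t t' : s <= t -> t' <= S ->
  lebesgue_measure.-integrable `[t, t'] (EFin \o rate H x i).
Proof.
move=> st tS; apply: continuous_compact_integrable; first exact: segment_compact.
apply: continuous_subspaceW (@rate_continuous i) => u /=.
by rewrite !in_itv/= => /andP[tu ut]; rewrite (le_trans st)// (le_trans ut).
Qed.

Lemma pullbackE i t : t \in `[s, S] -> flow_inv psi i t (x t 0 i) w =
  flow_inv psi i s (phi 0 0 i) w +
  \int[lebesgue_measure]_(u in `[s, t]) rate H x i u.
Proof.
move=> tJ; have [_ _ sx] := solx; rewrite (sx t i tJ) flowK//.
by move: tJ; rewrite in_itv/= => /andP[st _]; exact: le_trans st.
Qed.

Lemma pullback_increment i t t' : s <= t -> t <= t' -> t' <= S ->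
  flow_inv psi i t' (x t' 0 i) w = flow_inv psi i t (x t 0 i) w +
  \int[lebesgue_measure]_(u in `[t, t']) rate H x i u.
Proof.
move=> st tt' t'S.
rewrite !pullbackE ?in_itv/= ?st ?(le_trans st tt')// ?(le_trans tt' t'S)//.
rewrite -addrA; congr +%R.
rewrite -(@Rintegral_itv_obnd_cbnd _ t (BRight t')); last first.
  apply: integrableS (@rate_integrable i t t' st t'S) => //.
  by apply: subset_itvr; rewrite bnd_simp.
rewrite -(@Rintegral_itvB _ _ (BLeft s) (BRight t') t) ?bnd_simp//.
  by rewrite addrC subrK.
exact: rate_integrable.
Qed.

Lemma solution_restart s1 : s <= s1 -> s1 <= S ->
  is_solution psi H w s1 (hist_at r x s1) `[s1, S] x.
Proof.
move=> ss1 s1S; have s1J : s1 \in `[s, S] by rewrite in_itv/= ss1.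
split.
- apply: continuous_subspaceW solution_continuous => t /=; rewrite !in_itv/=.
  have r0 : 0 < r%:num by [].
  by case=> /andP[h1 h2]; apply/andP; split; lra.
- move=> t; rewrite in_itv/= => /andP[h1 h2].
  rewrite solution_hist_at// clamp_id; first by rewrite addrC subrK.
  by rewrite in_itv/=; apply/andP; split; lra.
- move=> t i; rewrite /= in_itv/= => /andP[h1 h2].
  rewrite solution_hist_at// clamp0 addr0 -pullback_increment//.
  by rewrite flow_invK// (le_trans s0)// (le_trans ss1).
Qed.

End path.

End solutions.

(** * Strict comparison by first touching *)

Lemma within_gt0 (R : realType) (f : R -> R) (A : set R) (t0 : R) :
  {within A, continuous f} -> A t0 -> 0 < f t0 ->
  \forall t \near t0, A t -> 0 < f t.
Proof.
move=> /subspace_continuousP cf At0 f0.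
have nf0 : nbhs (f t0) [set z | 0 < z].
  by apply: open_nbhs_nbhs; split => //; exact: open_gt.
by have := cf t0 At0 _ nf0; rewrite !nbhs_simpl /within /=.
Qed.

Lemma first_touching (R : realType) (n : nat) (u : 'I_n -> R -> R) (s S t : R) :
  (forall j, {within `[s, S], continuous (u j)}) -> (forall j, 0 < u j s) ->
  t \in `[s, S] -> (exists j, u j t <= 0) ->
  exists t0, [/\ s < t0 <= S, exists i, u i t0 = 0,
    forall j, 0 <= u j t0 & forall t' j, s <= t' < t0 -> 0 < u j t'].
Proof.
move=> cu us tJ [j0 ut].
pose A := [set t' | t' \in `[s, S] /\ exists j, u j t' <= 0].
have hA : has_inf A.
  split; first by exists t; split => //; exists j0.
  by exists s => a [+ _]; rewrite in_itv/= => /andP[].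
have lbA : lbound A (inf A) by exact: inf_lbound hA.2.
pose t0 := inf A.
have st0 : s <= t0.
  by apply: lb_le_inf hA.1 _ => a [+ _]; rewrite in_itv/= => /andP[].
have t0S : t0 <= S.
  apply: le_trans (lbA t _) _; first by split => //; exists j0.
  by move: tJ; rewrite in_itv/= => /andP[].
have t0J : `[s, S]%classic t0 by rewrite /= in_itv/= st0.
have pos t' j : s <= t' < t0 -> 0 < u j t'.
  move=> /andP[st' t't0]; rewrite ltNge; apply/negP => u0.
  have : A t'; last by move=> /lbA; rewrite leNgt t't0.
  by split; [rewrite in_itv/= st' (le_trans (ltW t't0))|exists j].
have [i ui] : exists i, u i t0 <= 0.
  apply/not_existsP => /(_ _)/negP h.
  have {}h j : 0 < u j t0 by rewrite ltNge; exact: h.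
  have : \forall t' \near t0, t' \in `[s, S] -> forall j, 0 < u j t'.
    have := filter_forall (nbhs_filter t0) (fun j => within_gt0 (cu j) t0J (h j)).
    by apply: filterS => t' ht' t'J j; exact: ht'.
  move=> /nbhs_ballP[e /= e0 he].
  have [a Aa] := inf_adherent e0 hA; have t0a := lbA _ Aa; case: Aa => aJ [j uj] ae.
  have ab : ball t0 e a.
    by rewrite /ball/= ltr_norml; apply/andP; split; rewrite /t0; lra.
  by have := he a ab aJ j; rewrite ltNge uj.
have {}st0 : s < t0.
  rewrite lt_neqAle st0 andbT; apply/eqP => e.
  by have := us i; rewrite e ltNge ui.
have nneg j : 0 <= u j t0.
  rewrite leNgt; apply/negP => uj.
  have cNu : {within `[s, S], continuous (fun t => - u j t)}.
    by move=> t'; apply: cvgN; exact: cu.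
  have := within_gt0 cNu t0J; rewrite oppr_gt0 => /(_ uj) /nbhs_ballP[e /= e0 he].
  pose t' := Num.max s (t0 - e / 2).
  have st' : s <= t' by rewrite /t' le_max lexx.
  have t't0 : t' < t0 by rewrite /t' gt_max st0/=; lra.
  have t'e : t0 - e / 2 <= t' by rewrite /t' le_max lexx orbT.
  have : 0 < - u j t'.
    apply: he; last by rewrite /= in_itv/= st' (le_trans (ltW t't0)).
    by rewrite /ball/= ltr_norml; apply/andP; split; lra.
  by rewrite oppr_gt0 ltNge ltW// pos// st'.
exists t0; split => //; first by rewrite st0.
by exists i; apply/eqP; rewrite eq_le ui nneg.
Qed.

Section strict_comparison.
Context {R : realType} {dsp : measure_display} {Omega : measurableType dsp}.
Context {d : nat} {r : {posnum R}} {psi : 'I_d -> R -> R -> R -> Omega -> R}.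
Hypothesis hpsi : C1_flow psi.
Variable w : Omega.

(** The sign [sg] treats lower and upper comparison at once.  The pulled back
    paths are continuously differentiable; where they first touch, the rates
    contradict the order which holds before. *)
Lemma strict_comparison (sg : R) (H K : R -> hist r d -> Omega -> 'rV[R]_d)
    (s S : R) (phi chi : hist r d) (z y : R -> 'rV[R]_d) :
  sg = 1 \/ sg = -1 -> 0 <= s ->
  drift_continuous w H -> drift_continuous w K ->
  is_solution psi H w s phi `[s, S] z -> is_solution psi K w s chi `[s, S] y ->
  (forall u j, sg * phi u 0 j <= sg * chi u 0 j) ->
  (forall j, sg * phi 0 0 j < sg * chi 0 0 j) ->
  (forall t i, t \in `[s, S] ->
    (forall u j, sg * hist_at r z t u 0 j <= sg * hist_at r y t u 0 j) ->
    z t 0 i = y t 0 i ->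
    sg * H t (hist_at r z t) w 0 i < sg * K t (hist_at r y t) w 0 i) ->
  forall t i, t \in `[s, S] -> sg * z t 0 i < sg * y t 0 i.
Proof.
move=> hsg s0 cH cK solz soly le0 lt0 key t i0 tJ.
rewrite ltNge; apply/negP => touch.
pose v j t' := sg * (y t' 0 j - z t' 0 j).
have sS : s <= S by move: tJ; rewrite in_itv/= => /andP[]; exact: le_trans.
have cv j : {within `[s, S], continuous (v j)}.
  have cy := @coord_within_continuous _ _ _ _ _ _ _ _ _ _ _ _ soly j.
  have cz := @coord_within_continuous _ _ _ _ _ _ _ _ _ _ _ _ solz j.
  by move=> u; apply: cvgM; [exact: cvg_cst|apply: cvgB; [exact: cy|exact: cz]].
have zs : z s = phi 0 by rewrite (solution_init solz) clamp0 addr0.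
have ys : y s = chi 0 by rewrite (solution_init soly) clamp0 addr0.
have vs j : 0 < v j s by rewrite /v zs ys mulrBr subr_gt0 lt0.
have vt : exists j, v j t <= 0 by exists i0; rewrite /v mulrBr subr_le0.
have [t0 [/andP[st0 t0S] [i vi] v0 vpos]] := first_touching cv vs tJ vt.
have t0J : t0 \in `[s, S] by rewrite in_itv/= ltW.
have zy : z t0 0 i = y t0 0 i.
  move/eqP: vi; rewrite mulf_eq0 subr_eq0 => /orP[|/eqP->//].
  by case: hsg => ->; rewrite ?oppr_eq0 oner_eq0.
have t0_ge0 : 0 <= t0 by rewrite (le_trans s0)// ltW.
have hle u j : sg * hist_at r z t0 u 0 j <= sg * hist_at r y t0 u 0 j.
  rewrite (solution_hist_at solz u t0J) (solution_hist_at soly u t0J).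
  have := clamp_shift_itv (r := r) t0 u; set t1 := t0 + clamp r u => /andP[h1 h2].
  have [t1s|t1s] := leP t1 s.
    have -> : z t1 = phi (t1 - s).
      by case: solz => _ + _; apply; rewrite in_itv/= t1s andbT; lra.
    have -> // : y t1 = chi (t1 - s).
    by case: soly => _ + _; apply; rewrite in_itv/= t1s andbT; lra.
  rewrite -subr_ge0 -mulrBr -/(v j t1); move: h2.
  rewrite le_eqVlt => /predU1P[->//|h2].
  by apply/ltW/vpos; rewrite ltW.
have := key t0 i t0J hle zy => lt_drift.
(* At the touching time both paths are pulled back by the same derivative. *)
have lt_rate : sg * rate (psi := psi) w H z i t0 < sg * rate (psi := psi) w K y i t0.
  rewrite /rate /flow_drift zy mulrCA [ltRHS]mulrCA ltr_pM2l//.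
  by rewrite invr_gt0 flow_deriv_gt0.
have cz := @rate_continuous _ _ _ _ _ _ hpsi w _ _ _ _ _ s0 cH solz i.
have cy := @rate_continuous _ _ _ _ _ _ hpsi w _ _ _ _ _ s0 cK soly i.
pose g t' := sg * rate (psi := psi) w K y i t' - sg * rate (psi := psi) w H z i t'.
have cg : {within `[s, S], continuous g}.
  by move=> u; apply: cvgB; apply: cvgM;
    [exact: cvg_cst|exact: cy|exact: cvg_cst|exact: cz].
have g0 : 0 < g t0 by rewrite subr_gt0.
have /nbhs_ballP[e /= e0 he] := within_gt0 cg t0J g0.
(* On [[t1, t0]] the rates are ordered, so that the pulled back paths were
   ordered the wrong way at time [t1]. *)
pose t1 := Num.max s (t0 - e / 2).
have st1 : s <= t1 by rewrite /t1 le_max lexx.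
have t1t0 : t1 < t0 by rewrite /t1 gt_max st0/=; lra.
have t1e : t0 - e / 2 <= t1 by rewrite /t1 le_max lexx orbT.
have rate_le u : `[t1, t0]%classic u ->
    sg * rate (psi := psi) w H z i u <= sg * rate (psi := psi) w K y i u.
  rewrite /= in_itv/= => /andP[t1u ut0]; rewrite -subr_ge0; apply/ltW/he.
    by rewrite /ball/= ltr_norml; apply/andP; split; lra.
  by rewrite /= in_itv/= (le_trans st1)// (le_trans ut0).
have Z := pullback_increment hpsi s0 cH solz i st1 (ltW t1t0) t0S.
have Y := pullback_increment hpsi s0 cK soly i st1 (ltW t1t0) t0S.
have iz := rate_integrable hpsi s0 cH solz i st1 t0S.
have iy := rate_integrable hpsi s0 cK soly i st1 t0S.
have t1_ge0 : 0 <= t1 by exact: le_trans st1.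
have := vpos t1 i; rewrite st1 t1t0 => /(_ isT).
have := flow_inv_lt hpsi w i (z t1 0 i) (y t1 0 i) t1_ge0.
have := flow_inv_lt hpsi w i (y t1 0 i) (z t1 0 i) t1_ge0.
rewrite /v => lt1 lt2.
move: Z Y; rewrite zy => -> ZY.
case: hsg => e1; rewrite e1 ?mul1r ?mulN1r ?oppr_gt0 ?subr_gt0 ?subr_lt0.
  rewrite -lt2; have :
      \int[lebesgue_measure]_(u in `[t1, t0]) rate (psi := psi) w H z i u <=
      \int[lebesgue_measure]_(u in `[t1, t0]) rate (psi := psi) w K y i u.
    by apply: le_Rintegral => // u /rate_le; rewrite e1 !mul1r.
  by move: ZY; lra.
rewrite -lt1; have :
    \int[lebesgue_measure]_(u in `[t1, t0]) rate (psi := psi) w K y i u <=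
    \int[lebesgue_measure]_(u in `[t1, t0]) rate (psi := psi) w H z i u.
  by apply: le_Rintegral => // u /rate_le; rewrite e1 !mulN1r lerN2.
by move: ZY; lra.
Qed.

End strict_comparison.

(** * Comparison on a short time interval *)

Section well_posedness.
Context {R : realType} {dsp : measure_display} {Omega : measurableType dsp}.
Context {d : nat} {r : {posnum R}} {psi : 'I_d -> R -> R -> R -> Omega -> R}.

(** Uniqueness identifies [x] with the solution that well-posedness provides, and
    the latter depends continuously on the initial history, also as regards its
    life time. *)
Lemma well_posed_near (H : R -> hist r d -> Omega -> 'rV[R]_d) w (s S t e : R)
    (phi : hist r d) (x : R -> 'rV[R]_d) :
  well_posed psi H w -> 0 <= s ->
  is_solution psi H w s phi [set u | s <= u < S] x -> s <= t < S -> 0 < e ->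
  exists2 rho : R, 0 < rho & forall phi', `|phi - phi'| < rho ->
    exists S' x', [/\ t < S', is_solution psi H w s phi' [set u | s <= u < S'] x' &
      `|x t - x' t| < e].
Proof.
move=> wp s0 solx /andP[st tS] e0.
have [tau [X [solX _ uniX openX contX]]] := wp s s0.
have JE : [set u | s <= u < S] = [set u | s <= u /\ (u%:E < S%:E)%E].
  by apply/seteqP; split=> u /=; rewrite lte_fin => /andP.
rewrite JE in solx; have [Stau xX] := uniX phi S%:E x solx.
have ttau : (t%:E < tau phi)%E by apply: lt_le_trans Stau; rewrite lte_fin.
rewrite (xX t st) ?lte_fin//.
have dt : s <= (t, phi).1 /\ ((t, phi).1%:E < tau (t, phi).2)%E by [].
have := openX (t, phi) dt.
have := iffLR (subspace_continuousP _ _) contX (t, phi) dt.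
move=> /cvgrPdist_lt/(_ _ e0); rewrite near_withinE /=.
move=> /nbhs_ballP[a1 /= a10 h1] /nbhs_ballP[a2 /= a20 h2].
exists (Num.min a1 a2); first by rewrite lt_min a10.
move=> phi'; rewrite lt_min => /andP[pa1 pa2].
have b1 : ball (t, phi) a1 (t, phi').
  by split => /=; [exact: ballxx|rewrite -ball_normE].
have b2 : ball (t, phi) a2 (t, phi').
  by split => /=; [exact: ballxx|rewrite -ball_normE].
have dt' := h2 _ b2 st; have close := h1 _ b1 dt'.
have [S' tS' S'tau] : exists2 S', t < S' & (S'%:E <= tau phi')%E.
  move: dt' => [_ /=]; case: (tau phi') => [S'| |//].
    by rewrite lte_fin => ?; exists S'.
  by exists (t + 1); rewrite ?ltrDl// leey.
exists S', (X phi'); split => //.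
apply: is_solutionW (solX phi').2 => u /= /andP[su uS']; split => //.
by apply: lt_le_trans S'tau; rewrite lte_fin.
Qed.

End well_posedness.

Section short_time.
Context {R : realType} {dsp : measure_display} {Omega : measurableType dsp}.
Context {d : nat} {r : {posnum R}} {psi : 'I_d -> R -> R -> R -> Omega -> R}.
Hypothesis hpsi : C1_flow psi.
Variables (w : Omega) (H Hbar : R -> hist r d -> Omega -> 'rV[R]_d).
Variables (E : set 'rV[R]_d) (i0 : 'I_d) (sg K a S : R).
Hypotheses (kE : compact E) (cE : convex_rV E) (E0 : E !=set0).
Hypothesis hsg : sg = 1 \/ sg = -1.
Hypotheses (a0 : 0 <= a) (cHbar : drift_continuous w Hbar).

Let pert (l p q : R) := perturbed_drift E i0 (- sg * K) l p q H.

Hypothesis cpert : forall l p q, drift_continuous w (pert l p q).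
Hypothesis wp : forall (l : int) (p q : rat),
  well_posed psi (pert l%:~R (ratr p) (ratr q)) w.
Hypothesis one_sided : forall t (eta zeta : hist r d) (e : R) i, t \in `[a, S] ->
  hist_in E eta -> hist_in E zeta -> 0 <= e ->
  (forall u j, eta u 0 j <= zeta u 0 j + e) ->
  `|eta 0 0 i - zeta 0 0 i| <= e -> H t eta w 0 i <= H t zeta w 0 i + K * e.
Hypothesis H_le : forall t (zeta : hist r d) i, t \in `[a, S] -> hist_in E zeta ->
  sg * H t zeta w 0 i <= sg * Hbar t zeta w 0 i.

Lemma sgM (b : R) : sg * (sg * b) = b.
Proof. by case: hsg => ->; rewrite ?mul1r ?mulN1r ?opprK. Qed.

Lemma pert_in p q t (eta : hist r d) : hist_in E eta ->
  pert 0 p q t eta w = H t eta w.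
Proof.
move=> Eeta; rewrite /pert /perturbed_drift /penalty proj_hist_id// subrr.
by rewrite normr0 mulr0 mul0r addr0; apply/rowP => i; rewrite !mxE addr0.
Qed.

(** For [eta] outside of [E] the order of [H] is only available between the
    projection of [eta] and [zeta], up to the error [K * e] of [one_sided].  The
    penalty absorbs this error and the other term makes the inequality
    strict. *)
Lemma pert_key p q t i (eta zeta : hist r d) : t \in `[a, S] -> hist_in E zeta ->
  (forall u j, sg * eta u 0 j <= sg * zeta u 0 j) -> eta 0 0 i = zeta 0 0 i ->
  eta (p - t) 0 i0 != q ->
  sg * pert (- sg) p q t eta w 0 i < sg * Hbar t zeta w 0 i.
Proof.
move=> tJ Ezeta le_ez eq0 neq; apply: lt_le_trans (H_le i tJ Ezeta).
rewrite /pert /perturbed_drift /penalty !mxE.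
set e := `|eta - _|; set g := `|_ - q|.
have g0 : 0 < g by rewrite normr_gt0 subr_eq0.
have e0 : 0 <= e by exact: normr_ge0.
have Epi := proj_hist_in kE cE E0 eta.
have near_pi u j : `|eta u 0 j - proj_hist E eta u 0 j| <= e.
  apply: le_trans (hist_norm_ub _ u); rewrite hist_subE.
  by have := entry_le_norm (eta u - proj_hist E eta u) j; rewrite !mxE.
have base : sg * H t (proj_hist E eta) w 0 i <= sg * H t zeta w 0 i + K * e.
  move: le_ez; case: hsg => ->.
    move=> le_ez; rewrite !mul1r; apply: one_sided => //.
      move=> u j; have := le_ez u j; rewrite !mul1r.
      by have := near_pi u j; rewrite ler_norml => /andP[h1 h2]; lra.
    by rewrite -eq0 distrC.
  move=> le_ez; rewrite !mulN1r.
  have := @one_sided t zeta (proj_hist E eta) e i tJ Ezeta Epi e0.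
  move=> h; have {h} : H t zeta w 0 i <= H t (proj_hist E eta) w 0 i + K * e.
    apply: h; last by rewrite -eq0.
    move=> u j; have := le_ez u j; rewrite !mulN1r lerN2.
    by have := near_pi u j; rewrite ler_norml => /andP[h1 h2]; lra.
  lra.
rewrite !mulrDr !mulNr !mulrN -[sg * K * e]mulrA !sgM; lra.
Qed.

(** The two perturbed drifts agree along a path that took the value [q] at
    time [p], as long as [p] is in the memory. *)
Lemma pert_switch (s S1 : R) (phi : hist r d) (x : R -> 'rV[R]_d) l p q p' q' :
  s - r%:num <= p <= s -> phi (p - s) 0 i0 = q ->
  is_solution psi (pert 0 p' q') w s phi [set u | s <= u < S1] x ->
  is_solution psi (pert l p q) w s phi
    [set u | s <= u < Num.min S1 (p + r%:num)] x.
Proof.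
move=> ps phiq solx; apply: (@eq_is_solution _ _ _ _ _ _ _ (pert 0 p' q')).
  move=> t u /= /andP[st]; rewrite lt_min => /andP[tS1 tp] /andP[su ut].
  have solu : is_solution psi (pert 0 p' q') w s phi `[s, u] x.
    apply: is_solutionW solx => v /=; rewrite in_itv/= => /andP[sv vu].
    by rewrite sv (le_lt_trans vu)// (le_lt_trans ut).
  have uJ : u \in `[s, u] by rewrite in_itv/= su lexx.
  have up : u - r%:num <= p by rewrite lerBlDr ltW// (le_lt_trans ut).
  rewrite /pert /perturbed_drift /penalty (solution_hist_past solu uJ ps up).
  by rewrite phiq subrr normr0 mulr0 mul0r.
apply: is_solutionW solx => u /= /andP[su]; rewrite lt_min => /andP[uS1 _].
by rewrite su.
Qed.

(** As [p] stays in the memory up to time [t], the detecting term keeps the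
    drifts strictly ordered at any touching time. *)
Lemma comparison_strict (s t p q : R) (phi chi : hist r d) (x y : R -> 'rV[R]_d) :
  a <= s -> t <= S -> t - r%:num <= p -> s - r%:num <= p <= s ->
  is_solution psi (pert (- sg) p q) w s phi `[s, t] x ->
  is_solution psi Hbar w s chi `[s, t] y ->
  hist_in E chi -> (forall u, u \in `[s, t] -> E (y u)) ->
  (forall u j, sg * phi u 0 j < sg * chi u 0 j) -> phi (p - s) 0 i0 != q ->
  forall i, s <= t -> sg * x t 0 i < sg * y t 0 i.
Proof.
move=> as_ tS tp ps solx soly Echi Ey lt0 phiq i st.
have s0 : 0 <= s by exact: le_trans as_.
have tJ : t \in `[s, t] by rewrite in_itv/= st lexx.
have sc := strict_comparison hpsi hsg s0 (@cpert _ _ _) cHbar solx soly.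
apply: (sc) => // [u j|t1 i1 t1J le_h eq1]; first exact/ltW/lt0.
have [st1 t1t] : s <= t1 /\ t1 <= t by move: t1J; rewrite in_itv/= => /andP.
apply: pert_key => //.
- by rewrite in_itv/= (le_trans as_)// (le_trans t1t).
- exact: (solution_hist_in soly).
- rewrite (solution_hist_at solx _ t1J) (solution_hist_at soly _ t1J).
  by rewrite clamp0 addr0.
- by rewrite (solution_hist_past solx t1J ps)// (le_trans _ tp)// lerD2r.
Qed.

(** Continuous dependence on the initial history replaces a Lipschitz
    condition.  Let [x] be a solution.  Shifting its initial history by a small
    constant gives a solution [x1] near [x] with a rational value [q] at a
    rational time [p], just before [s].  The drift with the additional term
    that detects deviations from [q] at time [p] does not distinguish [x1] from
    its own solutions, but a further shift gives a solution [x2] near [x1] for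
    which the term is active.  Then [x2] and [y] are strictly ordered. *)
Lemma comparison_short (s : R) (phi chi : hist r d) (x y : R -> 'rV[R]_d) :
  a <= s ->
  is_solution psi H w s phi `[s, S] x -> is_solution psi Hbar w s chi `[s, S] y ->
  hist_in E phi -> hist_in E chi ->
  (forall t, t \in `[s, S] -> E (x t) /\ E (y t)) ->
  (forall u j, sg * phi u 0 j <= sg * chi u 0 j) ->
  forall t i, s <= t < S -> t <= s + r%:num / 2 -> sg * x t 0 i <= sg * y t 0 i.
Proof.
move=> as_ solx soly Ephi Echi Exy le0 t i /andP[st tS] tr.
have s0 : 0 <= s by exact: le_trans as_.
rewrite leNgt; apply/negP => yx; pose e := (sg * x t 0 i - sg * y t 0 i) / 2.
have e0 : 0 < e by rewrite divr_gt0// subr_gt0.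
have norm_sg b : `|sg * b| = `|b|.
  by case: hsg => ->; rewrite ?mul1r ?mulN1r ?normrN.
have solx0 : is_solution psi (pert 0%:~R (ratr 0) (ratr 0)) w s phi
    [set u | s <= u < S] x.
  apply: (@eq_is_solution _ _ _ _ _ _ _ H).
    move=> t' u /= /andP[st' t'S] /andP[su ut']; rewrite mulr0z pert_in//.
    apply: (solution_hist_in solx) => // [u' /Exy[]//|].
    by rewrite in_itv/= su (le_trans ut')// ltW.
  by apply: is_solutionW solx => u /= /andP[su uS]; rewrite in_itv/= su ltW.
have st_S : s <= t < S by rewrite st.
have [rho rho0 near1] := well_posed_near (wp 0 0 0) s0 solx0 st_S e0.
have r0 : 0 < r%:num by [].
have [p] : exists p : rat, ratr p \in `]s - r%:num / 2, s[.
  by apply: rat_in_itvoo; rewrite ltrBlDr ltrDl divr_gt0.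
rewrite in_itv/= => /andP[p1 p2].
have ps : s - r%:num <= ratr p <= s by apply/andP; split; lra.
have tp : t < ratr p + r%:num by lra.
set v := phi (ratr p - s) 0 i0 in near1 *.
have [q [q0 q1]] : exists q : rat, 0 < sg * (v - ratr q) /\ `|v - ratr q| < rho.
  have [q] : exists q : rat, ratr q \in `]sg * v - rho, sg * v[.
    by apply: rat_in_itvoo; rewrite ltrBlDr ltrDl.
  rewrite in_itv/= => /andP[h1 h2].
  have [q' q'E] : exists q' : rat, ratr q' = sg * ratr q.
    case: hsg => ->; first by exists q; rewrite mul1r.
    by exists (- q); rewrite rmorphN/= mulN1r.
  exists q'; rewrite q'E -norm_sg mulrBr sgM subr_gt0 ltr_norml; split=> //.
  by apply/andP; split; lra.
pose c := v - ratr q; pose phi1 := phi - cst_hist (const_mx c).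
have shiftE (f : hist r d) (k : R) u j :
    (f - cst_hist (const_mx k)) u 0 j = f u 0 j - k.
  change ((f u - cst_hist (r := r) (const_mx k) u) 0 j = f u 0 j - k).
  by rewrite cst_histE !mxE.
have shift_near (f : hist r d) (k b : R) : `|k| < b ->
    `|f - (f - cst_hist (const_mx k))| < b.
  by move=> kb; rewrite opprB addrC subrK; exact: le_lt_trans (norm_cst_hist k) kb.
have phi1p : phi1 (ratr p - s) 0 i0 = ratr q.
  by rewrite shiftE -/v /c opprB addrC subrK.
have [S1 [x1 [tS1 solx1 xx1]]] := near1 phi1 (shift_near _ _ _ q1).
rewrite mulr0z in solx1.
have [l lE] : exists l : int, l%:~R = - sg.
  by case: hsg => ->; [exists (-1)|exists 1]; rewrite ?opprK ?mulrNz.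
have {}solx1 := pert_switch l%:~R ps phi1p solx1.
have tS2 : s <= t < Num.min S1 (ratr p + r%:num) by rewrite st lt_min tS1.
have [rho' rho'0 near2] := well_posed_near (wp l p q) s0 solx1 tS2 e0.
pose c' := sg * (rho' / 2); pose phi2 := phi1 - cst_hist (const_mx c').
have c'_gt0 : 0 < sg * c' by rewrite /c' sgM divr_gt0.
have c'_lt : `|c'| < rho'.
  by rewrite /c' norm_sg gtr0_norm ?divr_gt0// ltr_pdivrMr// mulr_natr mulr2n ltrDl.
have [S3 [x2 [tS3 solx2 x1x2]]] := near2 phi2 (shift_near _ _ _ c'_lt).
rewrite lE in solx2.
have lt_init u j : sg * phi2 u 0 j < sg * chi u 0 j.
  apply: lt_le_trans (le0 u j); rewrite !shiftE (mulrBr sg _ c') (mulrBr sg _ c).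
  by rewrite -addrA -opprD gtrBl addr_gt0.
have x2y : sg * x2 t 0 i < sg * y t 0 i.
  apply: (@comparison_strict s t (ratr p) (ratr q) phi2 chi) => //.
  - exact: ltW.
  - by rewrite lerBlDr ltW.
  - apply: is_solutionW solx2 => u /=; rewrite in_itv/= => /andP[su ut].
    by rewrite su (le_lt_trans ut).
  - apply: is_solutionW soly => u /=; rewrite !in_itv/= => /andP[su ut].
    by rewrite su (le_trans ut)// ltW.
  - move=> u; rewrite in_itv/= => /andP[su ut].
    by apply: (Exy u _).2; rewrite in_itv/= su (le_trans ut)// ltW.
  - rewrite shiftE phi1p -subr_eq0 addrAC subrr add0r oppr_eq0.
    by apply: contraTneq c'_gt0 => ->; rewrite mulr0 ltxx.
have sg_entry (f g : 'rV[R]_d) : sg * f 0 i - sg * g 0 i <= `|f - g|.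
  rewrite -mulrBr; apply: le_trans (ler_norm _) _; rewrite norm_sg.
  by have := entry_le_norm (f - g) i; rewrite !mxE.
have d1 := le_lt_trans (sg_entry (x t) (x1 t)) xx1.
have d2 := le_lt_trans (sg_entry (x1 t) (x2 t)) x1x2.
by rewrite /e in d1 d2; lra.
Qed.

(** ** Comparison on the whole interval *)

(** A time step of [r / 2] keeps the memory within the reach of the initial
    history; the solutions are then restarted. *)
Lemma comparison_steps (n : nat) (s : R) (phi chi : hist r d) (x y : R -> 'rV[R]_d) :
  a <= s -> drift_continuous w H -> S - s <= n%:R * (r%:num / 2) ->
  is_solution psi H w s phi `[s, S] x -> is_solution psi Hbar w s chi `[s, S] y ->
  hist_in E phi -> hist_in E chi ->
  (forall t, t \in `[s, S] -> E (x t) /\ E (y t)) ->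
  (forall u j, sg * phi u 0 j <= sg * chi u 0 j) ->
  forall t i, s <= t < S -> sg * x t 0 i <= sg * y t 0 i.
Proof.
move=> as_ cH; elim: n => [|n IHn] in s phi chi as_ *.
  rewrite mul0r => Ss _ _ _ _ _ _ t i /andP[st tS]; lra.
move=> Ssn solx soly Ephi Echi Exy le0 t i /andP[st tS].
have short := comparison_short as_ solx soly Ephi Echi Exy le0.
pose s1 := s + r%:num / 2.
have [ts1|s1t] := leP t s1; first by apply: short => //; rewrite st.
have r0 : 0 < r%:num by [].
have ss1 : s <= s1 by rewrite /s1; lra.
have s1S : s1 <= S by rewrite ltW// (lt_trans s1t).
have s0 : 0 <= s by exact: le_trans as_.
have s1J : s1 \in `[s, S] by rewrite in_itv/= ss1.
apply: (IHn s1 (hist_at r x s1) (hist_at r y s1)).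
- exact: le_trans ss1.
- by rewrite /s1; move: Ssn; rewrite -natr1 mulrDl mul1r; lra.
- exact: (solution_restart hpsi s0 cH solx ss1 s1S).
- exact: (solution_restart hpsi s0 cHbar soly ss1 s1S).
- by apply: (solution_hist_in solx) => // u' /Exy[].
- by apply: (solution_hist_in soly) => // u' /Exy[].
- move=> t'; rewrite in_itv/= => /andP[h1 h2]; apply: Exy.
  by rewrite in_itv/= (le_trans ss1).
- move=> u j; rewrite (solution_hist_at solx _ s1J) (solution_hist_at soly _ s1J).
  have := clamp_shift_itv (r := r) s1 u; set t1 := s1 + clamp r u => /andP[h1 h2].
  have [t1s|t1s] := leP t1 s.
    have h3 : s - r%:num <= t1 <= s by rewrite t1s andbT; lra.
    by rewrite (solution_before solx)// (solution_before soly)//.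
  by apply: short => //; rewrite (ltW t1s)/= (le_lt_trans h2)// (lt_trans s1t).
- by rewrite (ltW s1t).
Qed.

(** Well-posedness concerns half-open time intervals; the end point is a matter
    of continuity. *)
Lemma comparison (s : R) (phi chi : hist r d) (x y : R -> 'rV[R]_d) :
  a <= s -> s < S -> drift_continuous w H ->
  is_solution psi H w s phi `[s, S] x -> is_solution psi Hbar w s chi `[s, S] y ->
  hist_in E phi -> hist_in E chi ->
  (forall t, t \in `[s, S] -> E (x t) /\ E (y t)) ->
  (forall u j, sg * phi u 0 j <= sg * chi u 0 j) ->
  forall t i, s <= t <= S -> sg * x t 0 i <= sg * y t 0 i.
Proof.
move=> as_ sS cH solx soly Ephi Echi Exy le0 t i /andP[st tS].
have r0 : 0 < r%:num / 2 by rewrite divr_gt0.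
have before t' : s <= t' < S -> sg * x t' 0 i <= sg * y t' 0 i.
  pose n := Num.bound ((S - s) / (r%:num / 2)).
  apply: (@comparison_steps n s phi chi) => //.
  rewrite -ler_pdivrMr//; apply/ltW/archi_boundP.
  by rewrite divr_ge0 ?(ltW r0)// subr_ge0 ltW.
move: tS; rewrite le_eqVlt => /predU1P[->|tS]; last by apply: before; rewrite st.
rewrite leNgt; apply/negP => yx.
pose g t' := sg * (x t' 0 i - y t' 0 i).
have cg : {within `[s, S], continuous g}.
  have cx := @coord_within_continuous _ _ _ _ _ _ _ _ _ _ _ _ solx i.
  have cy := @coord_within_continuous _ _ _ _ _ _ _ _ _ _ _ _ soly i.
  by move=> u; apply: cvgM; [exact: cvg_cst|apply: cvgB; [exact: cx|exact: cy]].
have gS : 0 < g S by rewrite /g mulrBr subr_gt0.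
have SJ : `[s, S]%classic S by rewrite /= in_itv/= lexx ltW.
have /nbhs_ballP[e /= e0 he] := within_gt0 cg SJ gS.
pose t1 := Num.max s (S - e / 2).
have st1 : s <= t1 by rewrite /t1 le_max lexx.
have t1S : t1 < S by rewrite /t1 gt_max sS/=; lra.
have t1e : S - e / 2 <= t1 by rewrite /t1 le_max lexx orbT.
have : 0 < g t1.
  apply: he; last by rewrite /= in_itv/= st1 ltW.
  by rewrite /ball/= ltr_norml; apply/andP; split; lra.
have := before t1; rewrite st1 t1S /g mulrBr subr_gt0 => /(_ isT).
by rewrite leNgt => /negP.
Qed.

End short_time.

(** * Truncation of the state space *)

Section truncation.
Context {R : realType} {d : nat}.
Variables (D : set 'rV[R]_d) (z0 : 'rV[R]_d) (rho : R).
Hypotheses (cD : convex_rV D) (clD : closed D).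
Hypothesis ballD : forall x, `|x - z0| <= rho -> D x.
Hypotheses (rho0 : 0 < rho) (rho1 : rho <= 1).

(** On a bounded set the drift has a Lipschitz constant, and every pair of paths
    in [D] over a compact time interval stays in one of these countably many
    sets. *)
Definition truncation (n : nat) : set 'rV[R]_d :=
  D `&` [set x | `|x - z0| <= n.+1%:R].

Lemma truncation_norm n x : truncation n x -> `|x| <= `|z0| + n.+1%:R.
Proof.
move=> [_ /= xn]; rewrite -[x](subrK z0) addrC.
by apply: le_trans (ler_normD _ _) _; rewrite lerD2l.
Qed.

Lemma dist_continuous (z : 'rV[R]_d) : continuous (fun x : 'rV[R]_d => `|x - z|).
Proof.
apply: (@lipschitz_continuous _ _ R^o _ 1) => x y; rewrite mul1r.
apply: le_trans (ler_dist_dist _ _) _.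
by rewrite opprB addrA subrK.
Qed.

Lemma truncation_compact n : compact (truncation n).
Proof.
apply: bounded_closed_compact.
  exists (`|z0| + n.+1%:R); split; first exact: num_real.
  move=> M /ltW zM x /truncation_norm xM; exact: le_trans zM.
apply: closedI => //.
apply: (@closed_comp _ _ (fun x : 'rV[R]_d => `|x - z0|) [set y | y <= n.+1%:R]).
  by move=> x _; exact: dist_continuous.
exact: closed_le.
Qed.

Lemma truncation_convex n : convex_rV (truncation n).
Proof.
move=> x y l [Dx /= xn] [Dy /= yn] l01; split; first exact: cD.
move: l01 => /andP[l0 l1] /=.
have -> : l *: x + (1 - l) *: y - z0 = l *: (x - z0) + (1 - l) *: (y - z0).
  by apply/rowP => j; rewrite !mxE; ring.
apply: le_trans (ler_normD _ _) _; rewrite !normrZ ger0_norm// ger0_norm ?subr_ge0//.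
have := ler_wpM2l l0 xn; have l1' : 0 <= 1 - l by rewrite subr_ge0.
by have := ler_wpM2l l1' yn; lra.
Qed.

Lemma truncation_ball n x : `|x - z0| <= rho -> truncation n x.
Proof.
move=> xr; split; first exact: ballD.
by apply: (le_trans xr); apply: (le_trans rho1); rewrite ler1n.
Qed.

Lemma truncation_neq0 n : truncation n !=set0.
Proof. by exists z0; apply: truncation_ball; rewrite subrr normr0 ltW. Qed.

End truncation.

Lemma interior_ball (R : realType) d (D : set 'rV[R]_d) : interior D !=set0 ->
  exists z0 rho, [/\ 0 < rho, rho <= 1 & forall x, `|x - z0| <= rho -> D x].
Proof.
move=> [z0 /nbhs_ballP[e /= e0 eD]].
exists z0, (Num.min 1 (e / 2)); split.
- by rewrite lt_min ltr01 divr_gt0.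
- by rewrite ge_min lexx.
- move=> x; rewrite le_min => /andP[_ xe]; apply: eD.
  by rewrite -ball_normE/= distrC; lra.
Qed.

(** * Comparison at a sample point *)

Section pathwise.
Context {R : realType} {dsp : measure_display} {Omega : measurableType dsp}.
Context {d : nat} {r : {posnum R}} {psi : 'I_d -> R -> R -> R -> Omega -> R}.
Hypothesis hpsi : C1_flow psi.
Variable (F : R -> set (set Omega)).
Hypothesis sF : forall t, 0 <= t -> sigma_algebra setT (F t).
Variables (b : R -> 'rV[R]_d -> Omega -> 'rV[R]_d).
Variables (G H Gbar Hbar : R -> hist r d -> Omega -> 'rV[R]_d).
Hypotheses (hG : admissible_drift F b G H) (hGbar : admissible_drift F b Gbar Hbar).
Variables (D : set 'rV[R]_d) (z0 : 'rV[R]_d) (rho : R) (i0 : 'I_d).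
Hypotheses (cD : convex_rV D) (clD : closed D).
Hypothesis ballD : forall x, `|x - z0| <= rho -> D x.
Hypotheses (rho0 : 0 < rho) (rho1 : rho <= 1).
Variable w : Omega.
Hypothesis wp : forall (n : nat) (k l : int) (p q : rat),
  well_posed psi (perturbed_drift (truncation D z0 n) i0 k%:~R l%:~R
    (ratr p) (ratr q) H) w.

Lemma path_bounded (x : R -> 'rV[R]_d) (c1 c2 : R) : c1 <= c2 ->
  {within `[c1, c2], continuous x} ->
  exists M, forall t, c1 <= t <= c2 -> `|x t - z0| <= M.
Proof.
move=> c12 cx.
have cf : {within `[c1, c2], continuous (fun t => `|x t - z0|)}.
  apply: (within_comp (B := setT) (f := fun v : 'rV[R]_d => `|v - z0|) cx) => //.
  exact: (continuous_subspaceT (@dist_continuous _ _ z0)).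
have [c _ cM] := EVT_max c12 cf.
by exists `|x c - z0| => t t12; apply: cM; rewrite in_itv.
Qed.

Lemma pathwise_comparison (sg s S : R) (phi chi : hist r d) (x y : R -> 'rV[R]_d) :
  sg = 1 \/ sg = -1 -> 0 <= s -> s < S ->
  is_solution psi H w s phi `[s, S] x -> is_solution psi Hbar w s chi `[s, S] y ->
  hist_in D phi -> hist_in D chi ->
  (forall t, s <= t <= S -> D (x t) /\ D (y t)) ->
  (forall (eta eta' : hist r d) t i, hist_in D eta -> hist_in D eta' ->
    s <= t <= S -> hist_le eta' eta -> eta 0 0 i = eta' 0 0 i ->
    H t eta' w 0 i <= H t eta w 0 i) ->
  (forall t (zeta : hist r d) i, s <= t <= S -> hist_in D zeta ->
    sg * H t zeta w 0 i <= sg * Hbar t zeta w 0 i) ->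
  (forall u j, sg * phi u 0 j <= sg * chi u 0 j) ->
  forall t i, s <= t <= S -> sg * x t 0 i <= sg * y t 0 i.
Proof.
move=> hsg s0 sS solx soly Dphi Dchi Dxy qm H_le le0.
have r0 : 0 < r%:num by [].
have rsS : s - r%:num <= S by lra.
have [M1 xM] := path_bounded rsS (solution_continuous solx).
have [M2 yM] := path_bounded rsS (solution_continuous soly).
(* The projection and the penalty refer to a truncation that contains both
   paths. *)
pose n := Num.bound (`|M1| + `|M2|).
have nM : `|M1| + `|M2| <= n.+1%:R.
  apply: le_trans (_ : n%:R <= _); last by rewrite ler_nat.
  by apply/ltW/archi_boundP; rewrite addr_ge0.
pose E := truncation D z0 n.
have kE : compact E by exact: truncation_compact.
have cE : convex_rV E by exact: truncation_convex.
have E0 : E !=set0 by exact: (truncation_neq0 ballD).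
have ED eta : hist_in E eta -> hist_in D eta.
  by move=> /hist_inP h; apply/hist_inP => u; exact: (h u).1.
have xn t : s - r%:num <= t <= S -> `|x t - z0| <= n.+1%:R.
  by move=> /xM h; apply: (le_trans h); apply: le_trans nM;
     rewrite (le_trans (ler_norm _))// lerDl.
have yn t : s - r%:num <= t <= S -> `|y t - z0| <= n.+1%:R.
  by move=> /yM h; apply: (le_trans h); apply: le_trans nM;
     rewrite (le_trans (ler_norm _))// lerDr.
have Ephi : hist_in E phi.
  apply/hist_inP => u; split; first exact: (iffLR (hist_inP _ _) Dphi).
  rewrite /= (solution_init solx); apply: xn.
  have /andP[h1 h2] := clamp_shift_itv (r := r) s u.
  by rewrite h1 (le_trans h2)// ltW.
have Echi : hist_in E chi.
  apply/hist_inP => u; split; first exact: (iffLR (hist_inP _ _) Dchi).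
  rewrite /= (solution_init soly); apply: yn.
  have /andP[h1 h2] := clamp_shift_itv (r := r) s u.
  by rewrite h1 (le_trans h2)// ltW.
have Exy t : t \in `[s, S] -> E (x t) /\ E (y t).
  rewrite in_itv/= => stS; have [Dx Dy] := Dxy t stS; move/andP: stS => [st tS].
  by split; (split; [|(apply: xn || apply: yn); apply/andP; split; lra]).
pose N := `|z0| + n.+1%:R.
have [_ _ [cH lH _] _ _] := hG; have [_ _ [cHbar _ _] _ _] := hGbar.
pose B := [set eta : hist r d | `|eta| <= N].
have bB : bounded_set B.
  exists N; split; first exact: num_real.
  by move=> M /ltW NM eta /= etaN; exact: le_trans NM.
have S0 : 0 < S by exact: le_lt_trans sS.
have [L LB] := lH w S B S0 bB.
pose K : R := (Num.bound (4 * N * `|L| / rho))%:R.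
have K_ge : 4 * N * `|L| / rho <= K.
  by apply/ltW/archi_boundP; rewrite divr_ge0 ?(ltW rho0)// !mulr_ge0// addr_ge0.
have one_sided t (eta zeta : hist r d) (e : R) i : t \in `[s, S] ->
    hist_in E eta -> hist_in E zeta -> 0 <= e ->
    (forall u j, eta u 0 j <= zeta u 0 j + e) ->
    `|eta 0 0 i - zeta 0 0 i| <= e -> H t eta w 0 i <= H t zeta w 0 i + K * e.
  rewrite in_itv/= => stS Eeta Ezeta e0 le_e eq_e.
  have t0S : 0 <= t <= S by case/andP: stS => st ->; rewrite (le_trans s0).
  apply: le_trans (_ : _ <= H t zeta w 0 i + 4 * N * `|L| / rho * e) _; last first.
    by rewrite lerD2l ler_wpM2r.
  apply: (quasimonotone_estimate cE rho0 _ _ (h := fun eta => H t eta w)) => //.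
  - exact: (truncation_ball ballD rho1).
  - by move=> v; exact: truncation_norm.
  - by move=> xi xi' /ED Exi /ED Exi'; exact: qm.
  - move=> xi xi' Bxi Bxi'; apply: le_trans (LB t xi xi' t0S Bxi Bxi') _.
    by rewrite ler_wpM2r// ler_norm.
have [k kK] : exists k : int, k%:~R = - sg * K.
  rewrite /K; set m := Num.bound _; case: hsg => ->.
    by exists (- m%:Z); rewrite mulN1r mulrNz.
  by exists m%:Z; rewrite opprK mul1r.
have cpert l p q : drift_continuous w (perturbed_drift E i0 (- sg * K) l p q H).
  by have [_ _ [+ _ _] _ _] :=
    perturbed_admissible kE cE E0 i0 (- sg * K) l p q sF hG; exact.
have wpert (l : int) (p q : rat) :
    well_posed psi (perturbed_drift E i0 (- sg * K) l%:~R (ratr p) (ratr q) H) w.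
  by rewrite -kK; exact: wp.
have H_leE t (zeta : hist r d) i : t \in `[s, S] -> hist_in E zeta ->
    sg * H t zeta w 0 i <= sg * Hbar t zeta w 0 i.
  by rewrite in_itv/= => stS /ED Dzeta; exact: H_le.
exact: (comparison hpsi kE cE E0 hsg s0 (cHbar w) cpert wpert one_sided H_leE
  (lexx s) sS (cH w) solx soly Ephi Echi Exy le0).
Qed.

End pathwise.

(** * The comparison theorem *)

Section exceptional_set.
Context {R : realType} {dsp : measure_display} {Omega : measurableType dsp}.
Variable P : probability Omega R.

Lemma ae_forall_count (I : countType) (Q : I -> Omega -> Prop) :
  (forall i, {ae P, forall w, Q i w}) -> {ae P, forall w, forall i, Q i w}.
Proof.
move=> aeQ.
have : {ae P, forall w, forall n, if unpickle n is Some i then Q i w else True}.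
  by apply: ae_foralln => n; case: unpickle => [i|]; [exact: aeQ|exact: aeW].
by apply: filterS => w Qw i; have := Qw (pickle i); rewrite pickleK.
Qed.

End exceptional_set.

Unset Implicit Arguments.

Theorem theorem4p2 (R : realType) (r : {posnum R}) (d : nat) (hd : (1 <= d)%N)
  (dsp : measure_display) (Omega : measurableType dsp) (P : probability Omega R)
  (F : R -> set (set Omega)) (hF : usual_filtration P F)
  (M : 'I_d -> R -> 'rV[R]_d -> Omega -> R)
  (hM : regular_local_martingale_field P F M)
  (hMdiag : forall (i : 'I_d) (t : R) (x x' : 'rV[R]_d) w, 0 <= t ->
     x 0 i = x' 0 i -> M i t x w = M i t x' w)
  (b : R -> 'rV[R]_d -> Omega -> 'rV[R]_d)
  (hbdiag : forall (i : 'I_d) (t : R) (x x' : 'rV[R]_d) w, 0 <= t ->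
     x 0 i = x' 0 i -> b t x w 0 i = b t x' w 0 i)
  (G H Gbar Hbar : R -> hist r d -> Omega -> 'rV[R]_d)
  (hG : admissible_drift F b G H) (hGbar : admissible_drift F b Gbar Hbar)
  (psi : 'I_d -> R -> R -> R -> Omega -> R)
  (hpsi : C1_flow psi) (hgen : generates_flow P F M b psi)
  (* the known well-posedness result for the pathwise equation *)
  (hwp : forall G' H' : R -> hist r d -> Omega -> 'rV[R]_d,
     admissible_drift F b G' H' -> {ae P, forall w, well_posed psi H' w})
  (D : set 'rV[R]_d) (hDconv : @convex_set R 'rV[R]_d D) (hDclosed : closed D)
  (hDint : interior D !=set0)
  (hDinv : forall s t w, 0 <= s -> s < t -> flow_map psi s t w @` D = D) :
  (* Omega0 is the sample space after the null set has been discarded *)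
  exists Omega0 : set Omega,
  [/\ P.-negligible (~` Omega0),
      forall w, Omega0 w -> well_posed psi H w /\ well_posed psi Hbar w &
  forall (s : R) (T : Omega -> R) (eta : Omega -> hist r d) (eta_ : hist r d)
    (x y : R -> Omega -> 'rV[R]_d),
    0 <= s ->
    (forall w, Omega0 w -> 0 < T w) ->
    measurable_wrt (F s) eta ->
    (forall w, Omega0 w -> hist_in D (eta w)) -> hist_in D eta_ ->
    (forall w, Omega0 w ->
       is_solution psi H w s (eta w) `[s, s + T w] (x ^~ w)) ->
    (forall w, Omega0 w ->
       is_solution psi Hbar w s eta_ `[s, s + T w] (y ^~ w)) ->
    (forall w t, Omega0 w -> s <= t <= s + T w -> D (x t w) /\ D (y t w)) ->
    quasimonotone Omega0 G (fun=> s) (fun w => s + T w) D ->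
    ((forall w, Omega0 w -> hist_le (eta w) eta_) ->
     (forall xi t w, hist_in D xi -> s <= t <= s + T w -> Omega0 w ->
        vec_le (G t xi w) (Gbar t xi w)) ->
     forall t w, Omega0 w -> s <= t <= s + T w -> vec_le (x t w) (y t w)) /\
    ((forall w, Omega0 w -> hist_le eta_ (eta w)) ->
     (forall xi t w, hist_in D xi -> s <= t <= s + T w -> Omega0 w ->
        vec_le (Gbar t xi w) (G t xi w)) ->
     forall t w, Omega0 w -> s <= t <= s + T w -> vec_le (y t w) (x t w))].
Proof.
have sF t : 0 <= t -> sigma_algebra setT (F t) by case: hF => h _ _ _ /h[].
have cD := convex_rVP hDconv.
have [z0 [rho [rho0 rho1 ballD]]] := interior_ball hDint.
pose i0 : 'I_d := Ordinal hd.
(* The countably many perturbed drifts to which well-posedness is applied. *)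
pose pert (k : nat * (int * int) * (rat * rat)) :=
  perturbed_drift (truncation D z0 k.1.1) i0 k.1.2.1%:~R k.1.2.2%:~R
    (ratr k.2.1) (ratr k.2.2) H.
pose Omega0 := [set w | (well_posed psi H w /\ well_posed psi Hbar w) /\
  forall k, well_posed psi (pert k) w].
exists Omega0; split; [|by move=> w []|].
  have wp_pert : {ae P, forall w, forall k, well_posed psi (pert k) w}.
    apply: ae_forall_count => -[[n [k l]] [p q]].
    have kE : compact (truncation D z0 n) by exact: truncation_compact.
    have cE : convex_rV (truncation D z0 n) by exact: truncation_convex.
    have E0 : truncation D z0 n !=set0 by exact: (truncation_neq0 ballD).
    exact: (hwp _ _ (perturbed_admissible kE cE E0 i0 k%:~R l%:~R
      (ratr p) (ratr q) sF hG)).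
  exact: (filterI (filterI (hwp _ _ hG) (hwp _ _ hGbar)) wp_pert).
move=> s T eta eta_ x y s0 T0 _ Deta Deta_ solx soly Dxy qm.
have [GE _ _ _ _] := hG; have [GbarE _ _ _ _] := hGbar.
have H_qm w (xi xi' : hist r d) t i : Omega0 w -> hist_in D xi -> hist_in D xi' ->
    s <= t <= s + T w -> hist_le xi' xi -> xi 0 0 i = xi' 0 0 i ->
    H t xi' w 0 i <= H t xi w 0 i.
  move=> w0 Dxi Dxi' tsT le_xi eq_xi; have t0 : 0 <= t.
    by case/andP: tsT => st _; exact: le_trans st.
  have := qm xi xi' t w i Dxi Dxi' w0 tsT le_xi eq_xi.
  by rewrite !GE// !mxE (hbdiag i t (xi' 0) (xi 0) w)// lerD2r.
have HHbar w (xi : hist r d) t i : s <= t -> Gbar t xi w 0 i - G t xi w 0 i =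
    Hbar t xi w 0 i - H t xi w 0 i.
  by move=> st; rewrite GE ?GbarE ?(le_trans s0)// !mxE; ring.
have main (sg : R) w : sg = 1 \/ sg = -1 -> Omega0 w ->
    (forall u j, sg * eta w u 0 j <= sg * eta_ u 0 j) ->
    (forall t (zeta : hist r d) i, s <= t <= s + T w -> hist_in D zeta ->
      sg * H t zeta w 0 i <= sg * Hbar t zeta w 0 i) ->
    forall t i, s <= t <= s + T w -> sg * x t w 0 i <= sg * y t w 0 i.
  move=> hsg w0 le0 H_le.
  have wp (n : nat) (k l : int) (p q : rat) := w0.2 (n, (k, l), (p, q)).
  apply: (pathwise_comparison hpsi sF hG hGbar cD hDclosed ballD rho0 rho1 wp
    hsg s0 _ (solx w w0) (soly w w0) (Deta w w0) Deta_ _ _ H_le le0) => //.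
  - by rewrite ltrDl T0.
  - by move=> t; exact: Dxy.
  - by move=> xi xi' t i Dxi Dxi' tsT; exact: H_qm.
split=> [le0 G_le|le0 G_le] t w w0 tsT i.
- have := main 1 w (or_introl erefl) w0 _ _ t i tsT; rewrite !mul1r; apply.
    by move=> u j; rewrite !mul1r; exact: (iffLR (hist_leP _ _) (le0 w w0)).
  move=> t' zeta j t'sT Dzeta; rewrite !mul1r -subr_ge0 -HHbar.
    by rewrite subr_ge0 G_le.
  by case/andP: t'sT.
- have := main (-1) w (or_intror erefl) w0 _ _ t i tsT.
  rewrite !mulN1r lerN2; apply.
    by move=> u j; rewrite !mulN1r lerN2; exact: (iffLR (hist_leP _ _) (le0 w w0)).
  move=> t' zeta j t'sT Dzeta; rewrite !mulN1r lerN2 -subr_le0 -HHbar.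
    by rewrite subr_le0 G_le.
  by case/andP: t'sT.
Qed.
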